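(* Let $\mathbf V$ be either a semigroup variety, different from the variety of all semigroups, which is a modular element of the lattice $\mathbb{SEM}$, or an epigroup variety which is a modular element of the lattice $\mathbb{EPI}$. Then $\mathbf V=\mathbf M\vee\mathbf N$, where $\mathbf M\in\{\mathbf T,\mathbf{SL}\}$ and $\mathbf N$ is a nil-variety satisfying the following three conditions. (a) For each non-substitutive identity $\mathbf u\approx\mathbf v$ which holds in $\mathbf N$, the identities $\mathbf u\approx 0$ and $\mathbf v\approx 0$ also hold in $\mathbf N$. (b) For each word $\mathbf u$, if $\mathbf N$ does not satisfy $\mathbf u\approx 0$, then $\mathrm{Stab}_{\mathbf N}(\mathbf u)$ is a modular element of the lattice $\mathrm{Sub}(S(\mathrm{alph}(\mathbf u)))$. (c) There are no incomparable words $\mathbf u$ and $\mathbf v$ such that $\mathrm{alph}(\mathbf u)=\mathrm{alph}(\mathbf v)$ and one of the following holds: (1) the common alphabet has 3 letters and $\mathrm{Stab}_{\mathbf N}(\mathbf u),\mathrm{Stab}_{\mathbf N}(\mathbf v)\in\{T_{12},T_{23},T_{13}\}$; (2) the common alphabet has 3 letters, $\mathrm{Stab}_{\mathbf N}(\mathbf u)\in\{T_{12},T_{23},T_{13}\}$ and $\mathrm{Stab}_{\mathbf N}(\mathbf v)=A_3$; (3) the common alphabet has 4 letters and $\mathrm{Stab}_{\mathbf N}(\mathbf u),\mathrm{Stab}_{\mathbf N}(\mathbf v)\in\{I_{12,34},I_{13,24},I_{14,23}\}$; (4) the common alphabet has 4 letters, $\mathrm{Stab}_{\mathbf N}(\mathbf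 u)\in\{I_{12,34},I_{13,24},I_{14,23}\}$ and $\mathrm{Stab}_{\mathbf N}(\mathbf v)=A_4$.
   Context: An element $x$ of a lattice $L$ is modular if for all $y,z\in L$ with $y\le z$ one has $(x\vee y)\wedge z=(x\wedge z)\vee y$. A variety is a class of algebras of a fixed type closed under homomorphic images, subalgebras and direct products. $\mathbb{SEM}$ is the lattice of all semigroup varieties under inclusion. An epigroup is a semigroup $S$ in which every element $x$ has a power lying in some subgroup of $S$. If $e_x$ is the unit of the maximal subgroup $G$ containing some power of $x$, then $xe_x=e_xx\in G$, and $\overline x$ (the pseudoinverse of $x$) is the inverse of $xe_x$ in $G$. Epigroups are treated as algebras with multiplication and the unary operation $x\mapsto\overline x$; an epigroup variety is a variety of such algebras consisting of epigroups, and $\mathbb{EPI}$ is the lattice of all epigroup varieties under inclusion. $\mathbf T$ is the trivial variety; $\mathbf{SL}$ is the variety of semilattices, given by $x^2\approx x$, $xy\approx yx$. A nilsemigroup is a semigroup with zero $0$ such that every element $s$ satisfies $s^n=0$ for some positive integer $n$. A nil-variety is a variety consisting of nilsemigroups. Periodic epigroup varieties (in particular nil-varieties) are identified with periodic semigroup varieties, since there pseudoinversion is expressible through multiplication; accordingly only semigroup words and identities are considered. $F$ is the free semigroup of countably infinite rank, $F^1$ the free monoid. Words are elements of $F$; $\mathrm{alph}(\mathbf w)$ is the set of letters occurring in $\mathbf w$. The expression $\mathbf w\approx0$ denotes the identity system $\mathbf wx\approx x\mathbf w\approx\mathbf w$, where $x$ is a letter not occurring in $\mathbf w$. An identity $\mathbf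 u\approx\mathbf v$ is substitutive if $\mathrm{alph}(\mathbf u)=\mathrm{alph}(\mathbf v)$ and $\mathbf v$ is obtained from $\mathbf u$ by renaming letters (i.e. by a permutation of $\mathrm{alph}(\mathbf u)$). For words $\mathbf u,\mathbf v$ write $\mathbf u\le\mathbf v$ if $\mathbf v=\mathbf a\,\xi(\mathbf u)\,\mathbf b$ for some endomorphism $\xi$ of $F$ and some $\mathbf a,\mathbf b\in F^1$. Words $\mathbf u$ and $\mathbf v$ are incomparable if $\mathbf u\not\le\mathbf v$ and $\mathbf v\not\le\mathbf u$. $S(X)$ is the symmetric group on a set $X$, $S_n=S(\{1,\dots,n\})$, and $\mathrm{Sub}(G)$ is the subgroup lattice of $G$. For a variety $\mathbf N$ and a word $\mathbf u$, $\mathrm{Stab}_{\mathbf N}(\mathbf u)=\{\sigma\in S(\mathrm{alph}(\mathbf u))\mid \mathbf u\approx\sigma(\mathbf u)\text{ holds in }\mathbf N\}$, where $\sigma$ acts on words by renaming letters; this is a subgroup of $S(\mathrm{alph}(\mathbf u))$. In (c), the common alphabet is $\{x_1,\dots,x_k\}$ ($k=3$ or $4$), its letters being identified with $1,\dots,k$ by some enumeration (the same for $\mathbf u$ and $\mathbf v$), so that the stabilizers become subgroups of $S_k$; the conditions do not depend on the enumeration. $T_{ij}$ is the subgroup of $S_3$ generated by the transposition $(ij)$. $A_k$ is the alternating subgroup of $S_k$. $I_{ij,st}$ (where $\{i,j,s,t\}=\{1,2,3,4\}$) is the subgroup of $S_4$ of order 8 consisting of the permutations preserving the partition $\{\{i,j\},\{s,t\}\}$,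 i.e. generated by $(ij)$, $(st)$ and $(is)(jt)$; it contains the Klein four-group $V_4=\{1,(12)(34),(13)(24),(14)(23)\}$. *)

(* Defs.v *)
From HB Require Import structures.
From mathcomp Require Import all_boot all_order all_fingroup all_solvable.
From mathcomp Require Import boolp.

Set Implicit Arguments.
Unset Strict Implicit.
Unset Printing Implicit Defensive.

Import Order.TTheory.

Definition modular_element d (L : latticeType d) (x : L) : Prop :=
  forall y z : L, (y <= z)%O ->
    Order.meet (Order.join x y) z = Order.join (Order.meet x z) y.

(* Algebras are nonempty, as usual. *)
Record semigroup := MkSemigroup {
  carrier :> Type;
  mul : carrier -> carrier -> carrier;
  mulA : forall x y z, mul x (mul y z) = mul (mul x y) z;
  carrier_inhabited : inhabited carrier
}.

Local Notation "x ** y" := (mul x y) (at level 40, left associativity).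

Record unary_semigroup := MkUnarySemigroup {
  reduct :> semigroup;
  un : reduct -> reduct
}.

Definition sg_hom (S T : semigroup) (f : S -> T) : Prop :=
  forall x y, f (x ** y) = f x ** f y.

Definition usg_hom (S T : unary_semigroup) (f : S -> T) : Prop :=
  sg_hom f /\ forall x, f (un x) = un (f x).

Definition surjective (A B : Type) (f : A -> B) : Prop :=
  forall y, exists x, f x = y.

Section Products.
Variable I : Type.

Section SemigroupProduct.
Variable S : I -> semigroup.

Definition prod_mul (x y : forall i, S i) : forall i, S i :=
  fun i => x i ** y i.

Lemma prod_mulA x y z : prod_mul x (prod_mul y z) = prod_mul (prod_mul x y) z.
Proof. by apply: functional_extensionality_dep => i; apply: mulA. Qed.

Lemma prod_inhabited : inhabited (forall i, S i).
Proof.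
have h i : exists _ : S i, True by case: (carrier_inhabited (S i)) => x; exists x.
by constructor=> i; case: (cid (h i)).
Qed.

Definition sg_prod : semigroup := MkSemigroup prod_mulA prod_inhabited.
End SemigroupProduct.

Definition usg_prod (S : I -> unary_semigroup) : unary_semigroup :=
  @MkUnarySemigroup (sg_prod S) (fun x i => un (x i)).
End Products.

(* An injective homomorphism T -> S presents T as a subalgebra of S up to
   isomorphism, and closure under homomorphic images includes closure under
   isomorphism. *)
Definition sg_variety (V : semigroup -> Prop) : Prop :=
  [/\ forall (S T : semigroup) (f : S -> T),
        sg_hom f -> surjective f -> V S -> V T,
      forall (S T : semigroup) (f : T -> S),
        sg_hom f -> injective f -> V S -> V T
    & forall (I : Type) (S : I -> semigroup),
        (forall i, V (S i)) -> V (sg_prod S)].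

Definition usg_variety (V : unary_semigroup -> Prop) : Prop :=
  [/\ forall (S T : unary_semigroup) (f : S -> T),
        usg_hom f -> surjective f -> V S -> V T,
      forall (S T : unary_semigroup) (f : T -> S),
        usg_hom f -> injective f -> V S -> V T
    & forall (I : Type) (S : I -> unary_semigroup),
        (forall i, V (S i)) -> V (usg_prod S)].

(* sg_exp x n is the power x^(n+1), so that "some positive power of x" is
   sg_exp x n for some n : nat. *)
Definition sg_exp (S : semigroup) (x : S) (n : nat) : S := iter n (mul x) x.

Definition is_subgroup (S : semigroup) (G : S -> Prop) (e : S) : Prop :=
  [/\ G e,
      forall x y, G x -> G y -> G (x ** y)
    & forall x, G x ->
        [/\ e ** x = x, x ** e = x
          & exists y, [/\ G y, x ** y = e & y ** x = e]]].

Definition is_maximal_subgroup (S : semigroup) (G : S -> Prop) (e : S) : Prop :=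
  is_subgroup G e /\
  forall (H : S -> Prop) (f : S), is_subgroup H f ->
    (forall x, G x -> H x) -> forall x, H x -> G x.

Definition is_epigroup (S : semigroup) : Prop :=
  forall x : S, exists (n : nat) (G : S -> Prop) (e : S),
    is_subgroup G e /\ G (sg_exp x n).

Definition is_pseudoinverse (S : semigroup) (x y : S) : Prop :=
  exists (G : S -> Prop) (e : S),
    [/\ is_maximal_subgroup G e,
        exists n, G (sg_exp x n),
        G y
      & (x ** e) ** y = e /\ y ** (x ** e) = e].

Definition is_epigroup_algebra (U : unary_semigroup) : Prop :=
  is_epigroup U /\ forall x : U, is_pseudoinverse x (un x).

Record SEM := MkSEM {
  sem_class :> semigroup -> Prop;
  sem_variety : sg_variety sem_class
}.

Record EPI := MkEPI {
  epi_class :> unary_semigroup -> Prop;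
  epi_variety : usg_variety epi_class;
  epi_epigroup : forall U, epi_class U -> is_epigroup_algebra U
}.

Lemma SEM_ext (V W : SEM) : (forall S, V S <-> W S) -> V = W.
Proof.
case: V W => V hV [W hW] /= h.
have E : V = W by apply: functional_extensionality_dep => S; apply/propext.
by subst W; congr MkSEM; apply: Prop_irrelevance.
Qed.

Lemma EPI_ext (V W : EPI) : (forall U, V U <-> W U) -> V = W.
Proof.
case: V W => V hV eV [W hW eW] /= h.
have E : V = W by apply: functional_extensionality_dep => S; apply/propext.
by subst W; congr MkEPI; apply: Prop_irrelevance.
Qed.

HB.instance Definition _ := gen_eqMixin SEM.
HB.instance Definition _ := gen_choiceMixin SEM.
HB.instance Definition _ := gen_eqMixin EPI.
HB.instance Definition _ := gen_choiceMixin EPI.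

Section SEMLattice.

Definition sem_le (V W : SEM) : bool := `[< forall S, V S -> W S >].

Lemma sem_le_refl : reflexive sem_le.
Proof. by move=> V; apply/asboolP. Qed.

Lemma sem_le_anti : antisymmetric sem_le.
Proof.
by move=> V W /andP[/asboolP h1 /asboolP h2]; apply: SEM_ext => S; split; auto.
Qed.

Lemma sem_le_trans : transitive sem_le.
Proof. by move=> V W X /asboolP h1 /asboolP h2; apply/asboolP => S; auto. Qed.

Lemma sem_meet_variety (V W : SEM) : sg_variety (fun S => V S /\ W S).
Proof.
case: V W => [V [hV sV pV]] [W [hW sW pW]] /=; split.
- by move=> S T f hf jf [? ?]; split; [apply: hV jf _ | apply: hW jf _].
- by move=> S T f hf jf [? ?]; split; [apply: sV jf _ | apply: sW jf _].
- by move=> I S h; split; [apply: pV => i | apply: pW => i]; case: (h i).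
Qed.

Definition sem_meet (V W : SEM) : SEM := MkSEM (sem_meet_variety V W).

Lemma sem_join_variety (V W : SEM) :
  sg_variety (fun S => forall X : SEM,
    (forall S', V S' -> X S') -> (forall S', W S' -> X S') -> X S).
Proof.
split.
- move=> S T f hf jf h X h1 h2; case: (sem_variety X) => H _ _.
  by apply: H hf jf _; apply: h.
- move=> S T f hf jf h X h1 h2; case: (sem_variety X) => _ H _.
  by apply: H hf jf _; apply: h.
- move=> I S h X h1 h2; case: (sem_variety X) => _ _ H.
  by apply: H => i; apply: h.
Qed.

Definition sem_join (V W : SEM) : SEM := MkSEM (sem_join_variety V W).

Lemma sem_meetP X V W : sem_le X (sem_meet V W) = sem_le X V && sem_le X W.
Proof.
apply/asboolP/andP => /= [h|[/asboolP h1 /asboolP h2] S]; last by auto.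
by split; apply/asboolP => S /h [].
Qed.

Lemma sem_joinP V W X : sem_le (sem_join V W) X = sem_le V X && sem_le W X.
Proof.
apply/asboolP/andP => /= [h|[/asboolP h1 /asboolP h2] S]; last by auto.
by split; apply/asboolP => S ?; apply: h; auto.
Qed.

End SEMLattice.

Fact sem_display : Order.disp_t. Proof. exact: Order.Disp tt tt. Qed.

HB.instance Definition _ :=
  Order.Le_isPOrder.Build sem_display SEM sem_le_refl sem_le_anti sem_le_trans.
HB.instance Definition _ :=
  Order.POrder_MeetJoin_isLattice.Build sem_display SEM sem_meetP sem_joinP.

Section Pseudoinverse.

Lemma sg_exp_comm (S : semigroup) (x y : S) n :
  x ** y = y ** x -> sg_exp x n ** y = y ** sg_exp x n.
Proof.
move=> c; elim: n => [//|n IH]; rewrite /sg_exp /= -/(sg_exp x n).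
by rewrite -mulA IH mulA c -mulA.
Qed.

Lemma pseudoinverseP (S : semigroup) (x y : S) :
  is_pseudoinverse x y <->
  [/\ x ** y = y ** x, y ** x ** y = y
    & exists n, sg_exp x n ** (x ** y) = sg_exp x n].
Proof.
split.
  move=> [G [e [[[Ge GM GU] _] [n Gn] Gy [xe ye]]]].
  have [exn xne [g [Gg xg gx]]] := GU _ Gn.
  have xc : x ** sg_exp x n = sg_exp x n ** x by rewrite sg_exp_comm.
  set p := sg_exp x n in xc exn xne xg gx.
  have h1 : e ** x ** e = x ** e.
    have -> : e ** x ** e = e ** (x ** p) ** g by rewrite -xg !mulA.
    by rewrite xc mulA exn -xc -mulA xg.
  have h2 : e ** x ** e = e ** x.
    have -> : e ** x ** e = g ** (p ** x) ** e by rewrite -gx !mulA.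
    by rewrite -xc -!mulA xne xc mulA gx.
  have c : x ** e = e ** x by rewrite -h1 h2.
  have [ey yey _] := GU _ Gy.
  have xy : x ** y = e by rewrite -{1}ey mulA.
  have yx : y ** x = e by rewrite -{1}yey -mulA -c.
  split; first by rewrite xy yx.
    by rewrite yx.
  by exists n; rewrite xy xne.
move=> [c yxy [n hn]].
pose e := x ** y.
have ey : e ** y = y by rewrite /e c.
have ye : y ** e = y by rewrite /e mulA.
have ee : e ** e = e by rewrite {1}/e -mulA ye.
pose G z := [/\ e ** z = z, z ** e = z &
  exists w, [/\ e ** w = w, w ** e = w, z ** w = e & w ** z = e]].
have SG : is_subgroup G e.
  split.
  - by split=> //; exists e.
  - move=> a b [ea ae [a' [ea' ae' aa' a'a]]] [eb be [b' [eb' be' bb' b'b]]].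
    split; rewrite ?mulA ?ea // -?mulA ?be //.
    exists (b' ** a'); split; rewrite ?mulA ?eb' // -?mulA ?ae' //.
    + by rewrite (mulA b) bb' ea'.
    + by rewrite (mulA a') a'a eb.
  - move=> a [ea ae [a' [ea' ae' aa' a'a]]]; split=> //; exists a'; split=> //.
    by split=> //; exists a.
have xec : x ** e = e ** x by rewrite /e -mulA c.
have xey : (x ** e) ** y = e by rewrite -mulA ey.
have yxe : y ** (x ** e) = e by rewrite mulA -c -/e ee.
exists G, e; split.
- split=> // H f [Hf HM HU] GH z Hz.
  have [_ ef0 [w [_ ew _]]] := HU e (GH e (let: And3 h _ _ := SG in h)).
  have ef : e = f by rewrite -{1}ef0 -ew mulA ee.
  have [fz zf [v [Hv zv vz]]] := HU z Hz.
  have [fv vf _] := HU v Hv.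
  by rewrite /G ef; split=> //; exists v.
- exists n; have ycx : sg_exp y n ** x = x ** sg_exp y n.
    by apply: sg_exp_comm.
  have pe : sg_exp x n ** e = sg_exp x n by [].
  have ep : e ** sg_exp x n = sg_exp x n.
    by rewrite -(sg_exp_comm (y := e) n xec).
  have qe m : sg_exp y m ** e = sg_exp y m /\ e ** sg_exp y m = sg_exp y m.
    split; last by case: m => [|m] //; rewrite /sg_exp /= mulA ey.
    by elim: m => [|m IH] //; rewrite /sg_exp /= -mulA IH.
  have pq m : sg_exp x m ** sg_exp y m = e.
    elim: m => [//|m IH]; rewrite /sg_exp /= -/(sg_exp x m) -/(sg_exp y m).
    have -> : y ** sg_exp y m = sg_exp y m ** y by rewrite sg_exp_comm.
    by rewrite -mulA (mulA (sg_exp x m)) IH ey.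
  have qp m : sg_exp y m ** sg_exp x m = e.
    rewrite -[RHS](pq m); apply: esym; apply: sg_exp_comm.
    by apply: esym; apply: sg_exp_comm.
  by split=> //; exists (sg_exp y n); case: (qe n).
- split=> //; exists (x ** e); split=> //.
  + by rewrite mulA -xec -mulA ee.
  + by rewrite -mulA ee.
- by [].
Qed.

Lemma pseudoinverse_epigroup (U : unary_semigroup) :
  (forall x : U, is_pseudoinverse x (un x)) -> is_epigroup_algebra U.
Proof.
move=> h; split=> // x; have [G [e [[sG _] [n Gn] _ _]]] := h x.
by exists n, G, e.
Qed.

Definition epi_bounded (n : nat) (U : unary_semigroup) : Prop :=
  forall x : U, [/\ x ** un x = un x ** x, un x ** x ** un x = un x
    & sg_exp x n ** (x ** un x) = sg_exp x n].

Lemma sg_hom_exp (S T : semigroup) (f : S -> T) : sg_hom f ->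
  forall x n, f (sg_exp x n) = sg_exp (f x) n.
Proof. by move=> h x; elim=> [//|n IH]; rewrite /sg_exp /= h -/(sg_exp x n) IH. Qed.

Lemma sg_exp_prod I (S : I -> semigroup) (x : sg_prod S) n i :
  sg_exp x n i = sg_exp (x i) n.
Proof. by elim: n => [//|n IH]; rewrite /sg_exp /= /prod_mul -/(sg_exp x n) IH. Qed.

Lemma epi_bounded_variety n : usg_variety (epi_bounded n).
Proof.
split.
- move=> S T f [hf uf] jf h y; have [x <-] := jf y; have [a b c] := h x.
  by split; rewrite -?sg_hom_exp // -uf -!hf ?a ?b ?c // -a c.
- move=> S T f [hf uf] jf h x; have [a b c] := h (f x).
  by split; apply: jf; rewrite ?sg_hom_exp // !hf ?sg_hom_exp // !uf.
- move=> I S h x; split; apply: functional_extensionality_dep => i /=;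
  have [a b c] := h i (x i); rewrite /= /prod_mul //= ?sg_exp_prod //.
Qed.

Lemma epi_bounded_epigroup n U : epi_bounded n U -> is_epigroup_algebra U.
Proof.
move=> h; apply: pseudoinverse_epigroup => x; apply/pseudoinverseP.
by have [a b c] := h x; split=> //; exists n.
Qed.

Lemma epi_bounded_mono m n U : m <= n -> epi_bounded m U -> epi_bounded n U.
Proof.
move=> /subnK <- h x; have [a b c] := h x; split=> //.
elim: (n - m) => [//|k IH]; rewrite /sg_exp addSn /= -/(sg_exp x (k + m)).
by rewrite -mulA IH.
Qed.

Lemma epi_boundedP (V : EPI) : exists n, forall U, V U -> epi_bounded n U.
Proof.
have alg (U : unary_semigroup) (x : U) : V U -> is_pseudoinverse x (un x).
  by move=> /(@epi_epigroup V)[].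
apply: contrapT => h.
have h1 n : exists p : {U : unary_semigroup & U}, V (projT1 p) /\
    sg_exp (projT2 p) n ** (projT2 p ** un (projT2 p)) <> sg_exp (projT2 p) n.
  apply: contrapT => h2; apply: h; exists n => U VU x.
  have /pseudoinverseP[a b _] := alg U x VU; split=> //.
  by apply: contrapT => h3; apply: h2; exists (existT _ U x).
have /choice[p hp] := h1.
have Vp : V (usg_prod (fun n => projT1 (p n))).
  by have [_ _ H] := epi_variety V; apply: H => n; case: (hp n).
have /pseudoinverseP[_ _ [n hn]] := 
  alg (usg_prod (fun n => projT1 (p n))) (fun n => projT2 (p n)) Vp.
case: (hp n) => _; apply.
by have := congr1 (fun g => g n) hn; rewrite /= /prod_mul sg_exp_prod.
Qed.

End Pseudoinverse.

Section EPILattice.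

Definition epi_le (V W : EPI) : bool := `[< forall U, V U -> W U >].

Lemma epi_le_refl : reflexive epi_le.
Proof. by move=> V; apply/asboolP. Qed.

Lemma epi_le_anti : antisymmetric epi_le.
Proof.
by move=> V W /andP[/asboolP h1 /asboolP h2]; apply: EPI_ext => S; split; auto.
Qed.

Lemma epi_le_trans : transitive epi_le.
Proof. by move=> V W X /asboolP h1 /asboolP h2; apply/asboolP => S; auto. Qed.

Lemma epi_meet_variety (V W : EPI) : usg_variety (fun U => V U /\ W U).
Proof.
case: V W => [V [hV sV pV] ?] [W [hW sW pW] ?] /=; split.
- by move=> S T f hf jf [? ?]; split; [apply: hV jf _ | apply: hW jf _].
- by move=> S T f hf jf [? ?]; split; [apply: sV jf _ | apply: sW jf _].
- by move=> I S h; split; [apply: pV => i | apply: pW => i]; case: (h i).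
Qed.

Lemma epi_meet_epigroup (V W : EPI) U : V U /\ W U -> is_epigroup_algebra U.
Proof. by case=> /epi_epigroup. Qed.

Definition epi_meet (V W : EPI) : EPI :=
  MkEPI (epi_meet_variety V W) (@epi_meet_epigroup V W).

Definition epi_join_class (V W : EPI) (U : unary_semigroup) : Prop :=
  forall X : EPI,
    (forall U', V U' -> X U') -> (forall U', W U' -> X U') -> X U.

Lemma epi_join_variety (V W : EPI) : usg_variety (epi_join_class V W).
Proof.
split.
- move=> S T f hf jf h X h1 h2; case: (epi_variety X) => H _ _.
  by apply: H hf jf _; apply: h.
- move=> S T f hf jf h X h1 h2; case: (epi_variety X) => _ H _.
  by apply: H hf jf _; apply: h.
- move=> I S h X h1 h2; case: (epi_variety X) => _ _ H.
  by apply: H => i; apply: h.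
Qed.

Lemma epi_join_epigroup (V W : EPI) U :
  epi_join_class V W U -> is_epigroup_algebra U.
Proof.
have [m hm] := epi_boundedP V; have [n hn] := epi_boundedP W.
pose X := MkEPI (epi_bounded_variety (maxn m n)) (@epi_bounded_epigroup _).
move=> /(_ X) h; apply: (@epi_epigroup X); apply: h => U' /=.
- by move=> /hm; apply: epi_bounded_mono; apply: leq_maxl.
- by move=> /hn; apply: epi_bounded_mono; apply: leq_maxr.
Qed.

Definition epi_join (V W : EPI) : EPI :=
  MkEPI (epi_join_variety V W) (@epi_join_epigroup V W).

Lemma epi_meetP X V W : epi_le X (epi_meet V W) = epi_le X V && epi_le X W.
Proof.
apply/asboolP/andP => /= [h|[/asboolP h1 /asboolP h2] S]; last by auto.
by split; apply/asboolP => S /h [].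
Qed.

Lemma epi_joinP V W X : epi_le (epi_join V W) X = epi_le V X && epi_le W X.
Proof.
apply/asboolP/andP => /= [h|[/asboolP h1 /asboolP h2] S]; last by move=> h; apply: h.
by split; apply/asboolP => S ?; apply: h => Y; auto.
Qed.

End EPILattice.

Fact epi_display : Order.disp_t. Proof. exact: Order.Disp tt tt. Qed.

HB.instance Definition _ :=
  Order.Le_isPOrder.Build epi_display EPI epi_le_refl epi_le_anti epi_le_trans.
HB.instance Definition _ :=
  Order.POrder_MeetJoin_isLattice.Build epi_display EPI epi_meetP epi_joinP.

Definition Subgroups (gT : finGroupType) : Type := {group gT}.

Section SubLattice.
Variable gT : finGroupType.

HB.instance Definition _ := Choice.on (Subgroups gT).

Definition sub_le (H K : Subgroups gT) : bool := H \subset K.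
Definition sub_meet (H K : Subgroups gT) : Subgroups gT := (H :&: K)%G.
Definition sub_join (H K : Subgroups gT) : Subgroups gT := (H <*> K)%G.

Lemma sub_le_refl : reflexive sub_le.
Proof. by move=> H; apply: subxx. Qed.

Lemma sub_le_anti : antisymmetric sub_le.
Proof. by move=> H K h; apply/val_inj/eqP; rewrite eqEsubset. Qed.

Lemma sub_le_trans : transitive sub_le.
Proof. by move=> H K L; apply: subset_trans. Qed.

Lemma sub_meetP H K L : sub_le H (sub_meet K L) = sub_le H K && sub_le H L.
Proof. exact: subsetI. Qed.

Lemma sub_joinP H K L : sub_le (sub_join H K) L = sub_le H L && sub_le K L.
Proof. exact: join_subG. Qed.

End SubLattice.

Fact sub_display : Order.disp_t. Proof. exact: Order.Disp tt tt. Qed.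

HB.instance Definition _ gT := Order.Le_isPOrder.Build
  sub_display (Subgroups gT) (@sub_le_refl gT) (@sub_le_anti gT) (@sub_le_trans gT).
HB.instance Definition _ gT := Order.POrder_MeetJoin_isLattice.Build
  sub_display (Subgroups gT) (@sub_meetP gT) (@sub_joinP gT).

Definition letter := nat.

(* The word x s_1 ... s_n is the pair (x, [:: s_1; ...; s_n]). *)
Definition word : Type := letter * seq letter.

Definition letters (w : word) : seq letter := w.1 :: w.2.

Definition word1 (x : letter) : word := (x, [::]).

Definition word_cat (u v : word) : word := (u.1, u.2 ++ letters v).

Lemma word_catA u v w :
  word_cat u (word_cat v w) = word_cat (word_cat u v) w.
Proof. by rewrite /word_cat /= -catA. Qed.

Definition F : semigroup := MkSemigroup word_catA (inhabits (word1 0)).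

Definition rename (f : letter -> letter) (w : word) : word :=
  (f w.1, map f w.2).

Definition eval (S : semigroup) (phi : letter -> S) (w : word) : S :=
  foldl (fun a x => a ** phi x) (phi w.1) w.2.

Definition sg_sat (S : semigroup) (u v : word) : Prop :=
  forall phi : letter -> S, eval phi u = eval phi v.

Definition sat (V : SEM) (u v : word) : Prop := forall S, V S -> sg_sat S u v.

Definition sat0 (V : SEM) (w : word) : Prop :=
  forall x : letter, x \notin letters w ->
    sat V (word_cat w (word1 x)) w /\ sat V (word_cat (word1 x) w) w.

(* An element a of the free monoid F^1 is a possibly empty sequence of
   letters. *)
Definition word_le (u v : word) : Prop :=
  exists (xi : F -> F) (a b : seq letter),
    sg_hom xi /\ letters v = a ++ letters (xi u) ++ b.

Definition incomparable (u v : word) : Prop := ~ word_le u v /\ ~ word_le v u.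

(* Given an injection e of a finite type T into the letters, a permutation of T
   acts on the letters in the image of e, and fixes the other letters. *)
Definition perm_letter (T : finType) (e : T -> letter) (s : {perm T})
  (x : letter) : letter :=
  if [pick i | e i == x] is Some i then e (s i) else x.

Definition perm_word (T : finType) (e : T -> letter) (s : {perm T}) :=
  rename (perm_letter e s).

Definition stab (N : SEM) (T : finType) (e : T -> letter) (u : word) :
    {set {perm T}} :=
  [set s | `[< sat N u (perm_word e s u) >]].

Section StabGroup.
Variables (N : SEM) (T : finType) (e : T -> letter) (inj_e : injective e).

Lemma perm_letterE s i : perm_letter e s (e i) = e (s i).
Proof.
rewrite /perm_letter; case: pickP => [j /eqP/inj_e -> //|/(_ i)].
by rewrite eqxx.
Qed.

Lemma perm_letter1 x : perm_letter e 1%g x = x.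
Proof. by rewrite /perm_letter; case: pickP => // i /eqP <-; rewrite perm1. Qed.

Lemma perm_letterM s t x :
  perm_letter e (s * t)%g x = perm_letter e t (perm_letter e s x).
Proof.
rewrite {1 3}/perm_letter; case: pickP => [i _|h].
  by rewrite perm_letterE permM.
by rewrite /perm_letter; case: pickP => // i; rewrite h.
Qed.

Lemma eval_rename (S : semigroup) (phi : letter -> S) f w :
  eval phi (rename f w) = eval (phi \o f) w.
Proof.
case: w => x s; rewrite /eval /=; elim: s (phi (f x)) => [//|y s IH] a /=.
exact: IH.
Qed.

Lemma stab_group_set u : group_set (stab N e u).
Proof.
apply/group_setP; split=> [|s t].
  rewrite inE; apply/asboolP => S _ phi; rewrite eval_rename; congr eval.
  by apply: functional_extensionality_dep => x /=; rewrite perm_letter1.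
rewrite !inE => /asboolP hs /asboolP ht; apply/asboolP => S NS phi.
rewrite (ht S NS) eval_rename (hs S NS) !eval_rename; congr eval.
by apply: functional_extensionality_dep => x /=; rewrite perm_letterM.
Qed.

Definition stab_group u : {group {perm T}} := Group (stab_group_set u).

End StabGroup.

Definition Alph (u : word) : finType := seq_sub (letters u).

Definition alph_val (u : word) : Alph u -> letter := val.

Lemma alph_val_inj u : injective (@alph_val u).
Proof. exact: val_inj. Qed.

Definition Stab (N : SEM) (u : word) : Subgroups {perm Alph u} :=
  stab_group N (@alph_val_inj u) u.

Definition substitutive (u v : word) : Prop :=
  letters u =i letters v /\
  exists s : {perm Alph u}, v = perm_word (@alph_val u) s u.

Lemma SEM_all_variety : sg_variety (fun _ => True).
Proof. by []. Qed.

Definition SEM_all : SEM := MkSEM SEM_all_variety.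

Lemma SEM_trivial_variety : sg_variety (fun S => forall x y : S, x = y).
Proof.
split.
- by move=> S T f _ jf h x y; case: (jf x) (jf y) => a <- [b <-]; rewrite (h a b).
- by move=> S T f _ jf h x y; apply: jf.
- by move=> I S h x y; apply: functional_extensionality_dep => i.
Qed.

Definition SEM_T : SEM := MkSEM SEM_trivial_variety.

Lemma SEM_SL_variety : sg_variety (fun S =>
  (forall x : S, x ** x = x) /\ (forall x y : S, x ** y = y ** x)).
Proof.
split.
- move=> S T f hf jf [h1 h2]; split=> [x|x y].
    by have [a <-] := jf x; rewrite -hf h1.
  by have [a <-] := jf x; have [b <-] := jf y; rewrite -!hf h2.
- by move=> S T f hf jf [h1 h2]; split=> *; apply: jf; rewrite !hf // h2.
- move=> I S h; split=> [x|x y]; apply: functional_extensionality_dep => i;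
  by case: (h i) => h1 h2; apply: h1 || apply: h2.
Qed.

Definition SL : SEM := MkSEM SEM_SL_variety.

Definition is_nilsemigroup (S : semigroup) : Prop :=
  exists z : S, (forall x, z ** x = z /\ x ** z = z) /\
    forall x, exists n, sg_exp x n = z.

Definition nil_variety (N : SEM) : Prop := forall S, N S -> is_nilsemigroup S.

(* W' is the epigroup variety that is identified with the periodic semigroup
   variety W: pseudoinversion is added to the members of W. *)
Definition identified (W' : EPI) (W : SEM) : Prop :=
  forall U : unary_semigroup, W' U <-> is_epigroup_algebra U /\ W U.

Definition condition_a (N : SEM) : Prop :=
  forall u v : word, ~ substitutive u v -> sat N u v -> sat0 N u /\ sat0 N v.

Definition condition_b (N : SEM) : Prop :=
  forall u : word, ~ sat0 N u -> modular_element (Stab N u).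

Definition enumerates (k : nat) (e : 'I_k -> letter) (u : word) : Prop :=
  injective e /\ codom e =i letters u.

(* The point i of {1, ..., k + 1} is encoded as the ordinal i - 1. *)
Definition pt (k : nat) (i : nat) : 'I_k.+1 := inord i.-1.

Definition T3 (i j : nat) : {set 'S_3} := <[tperm (pt 2 i) (pt 2 j)]>%g.

Definition I4 (i j s t : nat) : {set 'S_4} :=
  let P := [set [set pt 3 i; pt 3 j]; [set pt 3 s; pt 3 t]] in
  [set p : 'S_4 | [set p @: B | B : {set 'I_4} in P] == P].

Definition T3s : seq {set 'S_3} := [:: T3 1 2; T3 2 3; T3 1 3].
Definition I4s : seq {set 'S_4} := [:: I4 1 2 3 4; I4 1 3 2 4; I4 1 4 2 3].

(* For e enumerating alph(u), stab N e u is Stab_N(u) transported to S_k. *)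
Definition condition_c (N : SEM) : Prop :=
  ~ exists u v : word,
    [/\ incomparable u v, letters u =i letters v &
      [\/ exists e : 'I_3 -> letter,
            [/\ enumerates e u, stab N e u \in T3s & stab N e v \in T3s],
          exists e : 'I_3 -> letter,
            [/\ enumerates e u, stab N e u \in T3s
              & stab N e v = ('Alt_('I_3))%g],
          exists e : 'I_4 -> letter,
            [/\ enumerates e u, stab N e u \in I4s & stab N e v \in I4s]
        | exists e : 'I_4 -> letter,
            [/\ enumerates e u, stab N e u \in I4s
              & stab N e v = ('Alt_('I_4))%g]]].

(* Main.v *)
From Pilot Require Import Defs.
From mathcomp Require Import all_boot all_order all_fingroup all_solvable.
From mathcomp Require Import boolp.

Set Implicit Arguments.
Unset Strict Implicit.
Unset Printing Implicit Defensive.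

Import Pilot.Defs.

(** Varieties correspond to their theories, which are the fully invariant
    congruences of the free semigroup [F], in the opposite order. For a modular
    variety [V] with theory [v], and for theories [z] inside [y], this gives
    that [(v \/ z) /\ y] is contained in [(v /\ y) \/ z]
    ([weakly_modular_theory]). Each step of the proof chooses [z] and [y] such
    that the classes of some word [u] can be computed. A pair [(u, u')] from
    [v \/ z] and [y] is then connected by a chain of steps in [v /\ y] and in
    [z], and small classes of [u] force a prescribed identity into [v].

    Three families of theories suffice. Identifying words with a common suffix
    in an ideal shows that an identity [u = w] of [V], where [u] is not above
    [w], implies some [u = p u] with [p] nonempty ([left_multiple]). Collapsing
    all words that are longer than [u] shows that [V] is invariant under
    transpositions of letters of [u] if [u] equals a longer word in [V]
    ([swap_of_longer]). Identifying renamings of [u], or of [u] and another word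
    linked to it, transfers the modular law from the lattice of varieties to
    subgroups of the symmetric group on the letters of [u] ([stab_modular],
    [stab_prime_order]).

    A nontrivial identity of a modular variety implies an identity
    [x^m = x^m'] between powers, by [left_multiple]. Hence every word with a
    factor [x^m] equals a longer word, and its letters may be transposed. These
    transpositions imply that the high powers of the elements of a semigroup in
    [V] form a semilattice and that [x -> x^n] is an endomorphism
    ([swaps_semilattice_powers]); so [V] is the join of a nil-variety [N] with
    the variety of semilattices or with the trivial variety, and [V] satisfies
    all identities of [N] between words of equal content
    ([semilattice_powers_decomposition]).

    In a nil-variety the identity [u = p u] implies that [u] is zero, and this
    is condition (a). Condition (b) is [stab_modular]. For condition (c), link
    the incomparable words [u] and [v]: in the join with this theory both
    stabilizers act on [u], and [stab_prime_order] says that an element of prime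
    order of the group that they generate lies in one of them. In the cases of
    (c) some 3-cycle or transposition contradicts this, after the letters of one
    of the words have been permuted.

    In an epigroup variety, [x^n = x^n x (un x)] plays the role of an identity
    with a longer word, and the transpositions are obtained as before with nil
    test varieties ([epi_swaps]). So the pseudoinverse is a power, the variety is
    identified with a semigroup variety [W], and the modular law holds for [W]
    as far as the tests are aperiodic ([epi_weakly_modular]). All theories used
    above are aperiodic, so the conclusion follows from the same lemmas. *)

Local Notation "x ** y" := (mul x y) (at level 40, left associativity).

(** * Words and substitutions *)

Section Words.

Lemma letters_inj : injective letters.
Proof. by move=> [x s] [y t] [-> ->]. Qed.

Lemma letters_mul (u v : F) : letters (u ** v) = letters u ++ letters v.
Proof. by []. Qed.

Lemma word_ind (P : F -> Prop) :
  (forall x, P (word1 x)) -> (forall u x, P u -> P (u ** word1 x)) ->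
  forall u, P u.
Proof.
move=> h1 hm [x s]; elim/last_ind: s => [|s y IH]; first exact: h1.
by rewrite -cats1; apply: (hm (x, s)).
Qed.

Lemma eval_hom (S : semigroup) (phi : letter -> S) :
  sg_hom (eval phi : F -> S).
Proof.
move=> u; elim/word_ind => [x|v x IH].
  by case: u => a s; rewrite /eval /= foldl_cat.
have E (w : F) : eval phi (w ** word1 x : F) = eval phi w ** phi x.
  by case: w => a s; rewrite /eval /= foldl_cat.
by rewrite mulA !E IH mulA.
Qed.

Lemma evalM (S : semigroup) (phi : letter -> S) (u v : F) :
  eval phi (u ** v) = eval phi u ** eval phi v.
Proof. exact: eval_hom. Qed.

Lemma hom_ext (S : semigroup) (f g : F -> S) : sg_hom f -> sg_hom g ->
  (forall x, f (word1 x) = g (word1 x)) -> forall u, f u = g u.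
Proof. by move=> hf hg h; elim/word_ind => // u x IH; rewrite hf hg IH h. Qed.

Lemma hom_eval (S : semigroup) (f : F -> S) : sg_hom f ->
  forall u, f u = eval (fun x => f (word1 x)) u.
Proof. by move=> hf; apply: hom_ext => //; apply: eval_hom. Qed.

Lemma hom_comp (S T : semigroup) (f : S -> T) (phi : letter -> S) (u : word) :
  sg_hom f -> f (eval phi u) = eval (fun x => f (phi x)) u.
Proof.
move=> hf; apply: (@hom_ext T (fun u => f (eval phi u))) => //.
  by move=> a b; rewrite evalM hf.
exact: eval_hom.
Qed.

Lemma eval_eval (S : semigroup) (phi : letter -> S) (f : letter -> F) (u : word) :
  eval phi (eval f u) = eval (fun x => eval phi (f x)) u.
Proof. by rewrite (hom_comp f u (@eval_hom _ phi)). Qed.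

Lemma eval_word1 (u : word) : eval (word1 : letter -> F) u = u.
Proof. by rewrite -(@hom_eval F id). Qed.

Lemma renameE f (u : word) : rename f u = eval (fun x => word1 (f x) : F) u.
Proof. by rewrite -(eval_rename (word1 : letter -> F)) eval_word1. Qed.

Lemma letters_rename f u : letters (rename f u) = map f (letters u).
Proof. by []. Qed.

Lemma letters_eval (f : letter -> F) (u : word) :
  letters (eval f u) = flatten [seq letters (f x) | x <- letters u].
Proof.
elim/word_ind: u => [x|u x IH]; first by rewrite /= cats0.
by rewrite evalM letters_mul IH (letters_mul u) map_cat flatten_cat /= cats0.
Qed.

Lemma eval_in (S : semigroup) (phi psi : letter -> S) (u : word) :
  {in letters u, phi =1 psi} -> eval phi u = eval psi u.
Proof.
elim/word_ind: u => [x|u x IH] h; first by apply: h; rewrite inE.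
rewrite !evalM IH; last by move=> y hy; apply: h; rewrite letters_mul mem_cat hy.
by congr mul; apply: h; rewrite letters_mul mem_cat orbC mem_head.
Qed.

Lemma rename_comp f g (u : word) : rename f (rename g u) = rename (f \o g) u.
Proof. by apply: letters_inj; rewrite !letters_rename map_comp. Qed.

Lemma rename_in f g (u : word) :
  rename f u = rename g u <-> {in letters u, f =1 g}.
Proof.
split; last by move=> /eq_in_map h; apply: letters_inj.
by move=> /(congr1 letters); rewrite !letters_rename => /eq_in_map.
Qed.

Lemma rename_id (u : word) : rename id u = u.
Proof. by apply: letters_inj; rewrite letters_rename map_id. Qed.

Definition len (u : word) := size (letters u).

Lemma len_mul (u v : F) : len (u ** v) = len u + len v.
Proof. by rewrite /len letters_mul size_cat. Qed.

Lemma len_rename f u : len (rename f u) = len u.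
Proof. by rewrite /len letters_rename size_map. Qed.

Lemma size_letters_eval (f : letter -> F) s :
  size s <= size (flatten [seq letters (f x) | x <- s]).
Proof. by elim: s => //= x s IH; rewrite size_cat ltnS (leq_trans IH) ?leq_addl. Qed.

Lemma len_eval (f : letter -> F) u : len u <= len (eval f u).
Proof. by rewrite /len letters_eval; apply: size_letters_eval. Qed.

(** Words are nonempty, whereas the factors [p] and [q] of [p u q] may be empty. *)
Definition ctx (p q : seq letter) (u : F) : F :=
  if p is x :: s then (x, s ++ letters u ++ q) else (u.1, u.2 ++ q).

Lemma letters_ctx p q u : letters (ctx p q u) = p ++ letters u ++ q.
Proof. by case: p. Qed.

Lemma ctx0 u : ctx [::] [::] u = u.
Proof. by apply: letters_inj; rewrite letters_ctx cats0. Qed.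

Lemma eval_ctx (f : letter -> F) p q u : eval f (ctx p q u) =
  ctx (flatten [seq letters (f x) | x <- p]) (flatten [seq letters (f x) | x <- q])
      (eval f u).
Proof.
by apply: letters_inj; rewrite letters_eval !letters_ctx !map_cat !flatten_cat letters_eval.
Qed.

Lemma len_ctx p q u : len (ctx p q u) = size p + len u + size q.
Proof. by rewrite /len letters_ctx !size_cat addnA. Qed.

Lemma ctx_ctx p q p' q' u : ctx p q (ctx p' q' u) = ctx (p ++ p') (q' ++ q) u.
Proof. by apply: letters_inj; rewrite !letters_ctx -!catA. Qed.

Lemma word_leP (u v : word) :
  word_le u v <-> exists (f : letter -> F) p q, v = ctx p q (eval f u).
Proof.
split=> [[xi [a [b [hxi E]]]]|[f [p [q ->]]]].
  exists (fun x => xi (word1 x)), a, b; apply: letters_inj.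
  by rewrite letters_ctx -hom_eval.
by exists (eval f), p, q; split; [exact: eval_hom | rewrite letters_ctx].
Qed.

Lemma word_le_ctx u v p q (f : letter -> F) :
  word_le u v -> word_le u (ctx p q (eval f v)).
Proof.
move=> /word_leP[g [p' [q' ->]]]; apply/word_leP.
by rewrite eval_ctx ctx_ctx eval_eval; do 3 eexists.
Qed.

Lemma word_le_refl u : word_le u u.
Proof. by apply/word_leP; exists word1, [::], [::]; rewrite ctx0 eval_word1. Qed.

Lemma word_le_trans u v w : word_le u v -> word_le v w -> word_le u w.
Proof. by move=> h /word_leP[f [p [q ->]]]; apply: word_le_ctx. Qed.

Lemma word_le_rename f u : word_le u (rename f u).
Proof. by apply/word_leP; exists (fun x => word1 (f x)), [::], [::]; rewrite ctx0 renameE. Qed.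

Lemma word_le_len u v : word_le u v -> len u <= len v.
Proof.
move=> /word_leP[f [p [q ->]]]; rewrite len_ctx -addnA addnCA.
exact: leq_trans (len_eval f u) (leq_addr _ _).
Qed.

(** A substitution instance of [s] inside a word that is not longer than [s]
    leaves no room for a context or for images of length greater than one. *)
Lemma ctx_eval_rigid p q (f : letter -> F) s :
  len (ctx p q (eval f s)) <= len s ->
  [/\ p = [::], q = [::] & {in letters s, forall x, f x = word1 (f x).1}].
Proof.
rewrite len_ctx => h; have h1 := len_eval f s.
have h2 : len (eval f s) <= len s.
  by apply: leq_trans h; rewrite -addnA addnCA leq_addr.
have E : len (eval f s) = len s by apply/eqP; rewrite eqn_leq h1 h2.
have {}h : size p + size q = 0.
  by apply/eqP; rewrite -leqn0 -(leq_add2l (len s)) addn0 -{1}E addnCA addnA.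
split; [by case: p h | by case: q h => //= a q; rewrite addnS|].
move: h2; rewrite /len letters_eval; elim: (letters s) => //= x t IH.
rewrite size_cat => h3 y; rewrite inE.
have {}h3 : size (f x).2 + size (flatten [seq letters (f z) | z <- t]) <= size t.
  by rewrite -ltnS -addSn.
have h4 := size_letters_eval f t.
have h5 : size (f x).2 = 0.
  by apply/eqP; rewrite -leqn0 -(leq_add2r (size t)) add0n (leq_trans _ h3) ?leq_add2l.
case/predU1P => [-> | /IH]; first by case: (f x) h5 => a [].
by apply; move: h3; rewrite h5.
Qed.

Lemma ctx_eval_rename p q (f : letter -> F) s t :
  ctx p q (eval f s) = t -> len t <= len s ->
  exists g : letter -> letter, [/\ t = rename g s, p = [::], q = [::]
    & {in letters s, forall x, f x = word1 (g x)}].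
Proof.
move=> <- /ctx_eval_rigid[-> -> h]; exists (fun x => (f x).1).
by rewrite ctx0 renameE; split=> //; apply: eval_in.
Qed.

Lemma word_le_antisym u v : word_le u v -> word_le v u ->
  exists f, v = rename f u.
Proof.
move=> h /word_le_len hl; have /word_leP[f [p [q E]]] := h.
by have [g [-> _ _ _]] := ctx_eval_rename (esym E) hl; exists g.
Qed.

End Words.

(** * Identities and varieties *)

Section Birkhoff.

Inductive uterm (X : Type) : Type :=
| UVar of X
| UMul of uterm X & uterm X
| UUn of uterm X.

Fixpoint ueval (X : Type) (U : unary_semigroup) (phi : X -> U) (t : uterm X) : U :=
  match t with
  | UVar x => phi x
  | UMul s t => ueval phi s ** ueval phi t
  | UUn t => un (ueval phi t)
  end.

Fixpoint umap (X Y : Type) (f : X -> Y) (t : uterm X) : uterm Y :=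
  match t with
  | UVar x => UVar (f x)
  | UMul s t => UMul (umap f s) (umap f t)
  | UUn t => UUn (umap f t)
  end.

Fixpoint uvars (X : Type) (t : uterm X) : seq {classic X} :=
  match t with
  | UVar x => [:: x : {classic X}]
  | UMul s t => uvars s ++ uvars t
  | UUn t => uvars t
  end.

Lemma ueval_umap X Y (f : X -> Y) (U : unary_semigroup) (phi : Y -> U) t :
  ueval phi (umap f t) = ueval (fun x => phi (f x)) t.
Proof. by elim: t => //= [s -> t ->|t ->]. Qed.

Lemma ueval_in X (U : unary_semigroup) (phi psi : X -> U) (t : uterm X) :
  (forall x : {classic X}, x \in uvars t -> phi x = psi x) -> ueval phi t = ueval psi t.
Proof.
elim: t => //= [x|s IHs t IHt|t IH] h; first by apply: h; rewrite inE.
  by rewrite IHs ?IHt // => x hx; apply: h; rewrite mem_cat hx ?orbT.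
by rewrite IH.
Qed.

Section Subalgebra.
Variables (U : unary_semigroup) (P : U -> Prop).
Hypotheses (PM : forall x y, P x -> P y -> P (x ** y)) (PU : forall x, P x -> P (un x)).
Hypothesis P0 : exists x, P x.

Let sub_mul (x y : {x : U | P x}) : {x : U | P x} :=
  exist P (sval x ** sval y) (PM (svalP x) (svalP y)).

Lemma sub_mulA x y z : sub_mul x (sub_mul y z) = sub_mul (sub_mul x y) z.
Proof. by apply: eq_exist; rewrite /= mulA. Qed.

Lemma sub_inhabited : inhabited {x : U | P x}.
Proof. by case: P0 => x hx; constructor; exists x. Qed.

Definition sub_usg : unary_semigroup :=
  @MkUnarySemigroup (MkSemigroup sub_mulA sub_inhabited)
    (fun x => exist P (un (sval x)) (PU (svalP x))).
End Subalgebra.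

Definition usat (V : unary_semigroup -> Prop) (s t : uterm letter) : Prop :=
  forall U, V U -> forall phi : letter -> U, ueval phi s = ueval phi t.

(** Terms with variables from [U] itself are evaluated in a product of members
    of [V], with one factor for every pair of terms that [V] separates. The
    values form a subalgebra of the product, and since [U] satisfies the
    identities of [V], this subalgebra maps onto [U]. *)
Theorem birkhoff (V : unary_semigroup -> Prop) (U : unary_semigroup) :
  usg_variety V ->
  (forall s t, usat V s t -> forall phi : letter -> U, ueval phi s = ueval phi t) ->
  V U.
Proof.
move=> [VH VS VP] hU.
pose X : Type := carrier U.
pose sep (p : uterm X * uterm X) := exists A : {A : unary_semigroup | V A},
  exists phi : X -> sval A, ueval phi p.1 <> ueval phi p.2.
pose I := {p | sep p}.
pose A (i : I) := projT1 (cid (svalP i)).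
pose phi (i : I) := projT1 (cid (projT2 (cid (svalP i)))).
have phiP (i : I) : ueval (phi i) (sval i).1 <> ueval (phi i) (sval i).2.
  exact: (projT2 (cid (projT2 (cid (svalP i))))).
pose P := usg_prod (fun i => sval (A i)).
have VPr : V P by apply: VP => i; exact: svalP (A i).
pose g (x : X) : P := fun i => phi i x.
have gE (t : uterm X) i : (ueval g t : P) i = ueval (phi i) t.
  by elim: t => //= [s <- t <-|t <-].
have P0 : exists p, exists t, p = ueval g t.
  by case: (carrier_inhabited U) => x; exists (g x), (UVar x).
have PM (p q : P) : (exists t, p = ueval g t) -> (exists t, q = ueval g t) ->
    exists t, p ** q = ueval g t.
  by move=> [s ->] [t ->]; exists (UMul s t).
have PU (p : P) : (exists t, p = ueval g t) -> exists t, un p = ueval g t.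
  by move=> [s ->]; exists (UUn s).
pose C := sub_usg PM PU P0.
have VC : V C.
  apply: (VS P C sval) => // [[x hx] [y hy] /= E]; exact: eq_exist.
have key (s t : uterm X) : ueval g s = ueval g t ->
    ueval (id : X -> U) s = ueval (id : X -> U) t.
  move=> E; apply: contrapT => hne.
  case: (carrier_inhabited U) => x0.
  (* Only finitely many variables occur, so they can be replaced by letters. *)
  pose l := uvars s ++ uvars t.
  pose r (x : X) : letter := index (x : {classic X}) l.
  pose r' (n : letter) : X := nth (x0 : {classic X}) l n.
  have rK (x : {classic X}) : x \in l -> r' (r x) = x by move=> h; rewrite /r' nth_index.
  have ns : ~ usat V (umap r s) (umap r t).
    move=> /hU/(_ r'); rewrite !ueval_umap => E'; apply: hne.
    by rewrite -(ueval_in (phi := fun x => r' (r x))) ?E' => [|x hx];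
      [apply: ueval_in => x hx|]; rewrite rK // mem_cat hx ?orbT.
  have : sep (s, t).
    apply: contrapT => ns'; apply: ns => T VT psi; rewrite !ueval_umap.
    by apply: contrapT => h; apply: ns'; exists (exist V T VT), (fun x => psi (r x)).
  by move=> hst; apply: (phiP (exist sep (s, t) hst)); rewrite -!gE E.
pose h (c : C) : U := ueval (id : X -> U) (projT1 (cid (svalP c))).
have hE (c : C) t : sval c = ueval g t -> h c = ueval (id : X -> U) t.
  by move=> E; apply: key; rewrite -E; case: (cid _).
apply: (VH C U h) => //; last first.
  move=> x; exists (exist (fun p => exists t, p = ueval g t) (g x) (ex_intro _ (UVar x) erefl)).
  by rewrite (hE _ (UVar x)).
split=> [c d|c].
  have [s Es] := svalP c; have [t Et] := svalP d.
  by rewrite (hE _ _ Es) (hE _ _ Et) (hE _ (UMul s t)) //= Es Et.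
have [s Es] := svalP c.
by rewrite (hE _ _ Es) (hE _ (UUn s)) //= Es.
Qed.

(** Semigroups are treated as the unary semigroups whose unary operation is the
    identity map; then a term is worth the word of its letters. *)
Theorem sg_birkhoff (V : SEM) (S : semigroup) :
  (forall u v, sat V u v -> sg_sat S u v) -> V S.
Proof.
have [VH VS VP] := sem_variety V => hS.
pose W (U : unary_semigroup) := V U /\ forall x : U, un x = x.
have WV : usg_variety W.
  split.
  - move=> U T f [hf uf] sf [VU iU]; split; first exact: VH hf sf VU.
    by move=> y; have [x <-] := sf y; rewrite -uf iU.
  - move=> U T f [hf uf] jf [VU iU]; split; first exact: VS hf jf VU.
    by move=> x; apply: jf; rewrite uf iU.
  - move=> I U h; split; first by apply: VP => i; case: (h i).
    by move=> x; apply: functional_extensionality_dep => i; case: (h i) => _ /(_ (x i)).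
pose er : uterm letter -> F := fix er t := match t with
  | UVar x => word1 x | UMul s t => er s ** er t | UUn t => er t end.
have erE (U : unary_semigroup) (phi : letter -> U) t : (forall x : U, un x = x) ->
    ueval phi t = eval phi (er t).
  by move=> h; elim: t => //= [s -> t ->|t ->]; rewrite ?h // evalM.
suff [] : W (@MkUnarySemigroup S id) by [].
apply: birkhoff => // s t hst phi; rewrite !erE //.
apply: hS => T VT psi.
by have := hst (@MkUnarySemigroup T id) (conj VT (fun=> erefl)) psi; rewrite !erE.
Qed.

End Birkhoff.

(** * Fully invariant congruences *)

Record fully_invariant (r : F -> F -> Prop) : Prop := FullyInvariant {
  fic_refl : forall a, r a a;
  fic_sym : forall a b, r a b -> r b a;
  fic_trans : forall a b c, r a b -> r b c -> r a c;
  fic_mul : forall a b c d, r a b -> r c d -> r (a ** c) (b ** d);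
  fic_subst : forall (f : letter -> F) a b, r a b -> r (eval f a) (eval f b) }.

Lemma fic_ctx r p q a b : fully_invariant r -> r a b -> r (ctx p q a) (ctx p q b).
Proof.
move=> fr h.
have {}h : r (ctx p [::] a) (ctx p [::] b).
  case: p => [|x s]; first by rewrite !ctx0.
  have E c : ctx (x :: s) [::] c = ((x, s) : F) ** c.
    by apply: letters_inj; rewrite letters_ctx letters_mul cats0.
  by rewrite !E; apply: fic_mul (fic_refl fr _) h.
case: q => [|x s] //.
have E c : ctx p (x :: s) c = ctx p [::] c ** ((x, s) : F).
  by apply: letters_inj; rewrite letters_mul !letters_ctx cats0 catA.
by rewrite !E; apply: fic_mul h (fic_refl fr _).
Qed.

Lemma sg_satM (S : semigroup) (a b c d : F) :
  sg_sat S a b -> sg_sat S c d -> sg_sat S (a ** c) (b ** d).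
Proof. by move=> h k phi; rewrite !evalM h k. Qed.

Lemma sg_sat_subst (S : semigroup) (f : letter -> F) (a b : F) :
  sg_sat S a b -> sg_sat S (eval f a) (eval f b).
Proof. by move=> h phi; rewrite !eval_eval h. Qed.

Lemma sat_on_fic (I : Type) (A : I -> semigroup) (P : I -> Prop) :
  fully_invariant (fun a b => forall i, P i -> sg_sat (A i) a b).
Proof.
split=> [a i _ phi //|a b h i Pi phi|a b c h k i Pi phi|a b c d h k i Pi|f a b h i Pi].
- by rewrite h.
- by rewrite h // k.
- by apply: sg_satM; [apply: h | apply: k].
- exact: sg_sat_subst (h i Pi).
Qed.

Lemma sat_fic V : fully_invariant (sat V).
Proof. exact: (sat_on_fic id V). Qed.

Lemma sg_sat_fic S : fully_invariant (sg_sat S).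
Proof.
have [h1 h2 h3 h4 h5] := sat_on_fic (fun _ : unit => S) (fun=> True).
split=> [a|a b h|a b c h k|a b c d h k|f a b h].
- exact: (h1 a tt I).
- exact: (h2 a b (fun _ _ => h) tt I).
- exact: (h3 a b c (fun _ _ => h) (fun _ _ => k) tt I).
- exact: sg_satM.
- exact: sg_sat_subst.
Qed.

Lemma Var_variety (r : F -> F -> Prop) :
  sg_variety (fun S => forall u v, r u v -> sg_sat S u v).
Proof.
split=> [S T f hf sf h u v /h huv phi|S T f hf jf h u v /h huv phi|I S h u v ruv phi].
- have /choice[psi hpsi] x := sf (phi x).
  have E w : eval phi w = f (eval psi w).
    by rewrite hom_comp //; apply: eval_in => x _; rewrite hpsi.
  by rewrite !E huv.
- by apply: jf; rewrite !hom_comp // huv.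
- apply: functional_extensionality_dep => i.
  have E w : eval phi w i = eval (fun x => phi x i) w.
    by rewrite (@hom_comp (sg_prod S) (S i) (fun p => p i)).
  by rewrite !E; apply: h.
Qed.

Definition Var (r : F -> F -> Prop) : SEM := MkSEM (Var_variety r).

Section Quotient.
Variables (r : F -> F -> Prop) (fr : fully_invariant r).

Definition qclass : Type := {P : F -> Prop | exists u, P = r u}.
Definition cls (u : F) : qclass := exist _ (r u) (ex_intro _ u erefl).
Definition rep (c : qclass) : F := projT1 (cid (svalP c)).

Lemma clsE u v : cls u = cls v <-> r u v.
Proof.
split=> [/(congr1 sval) /= E|h]; first by rewrite E; apply: fic_refl.
apply: eq_exist => /=; apply: functional_extensionality_dep => w; apply/propext; split.
  exact: fic_trans (fic_sym fr h).
exact: fic_trans h.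
Qed.

Lemma repK c : cls (rep c) = c.
Proof. by case: c => P hP; apply: eq_exist; rewrite /rep; case: (cid _) => /= u ->. Qed.

Definition qmul (c d : qclass) : qclass := cls (rep c ** rep d).

Lemma cls_mul u v : qmul (cls u) (cls v) = cls (u ** v).
Proof. by apply/clsE; apply: (fic_mul fr); apply/clsE; rewrite repK. Qed.

Lemma qmulA c d e : qmul c (qmul d e) = qmul (qmul c d) e.
Proof. by rewrite -(repK c) -(repK d) -(repK e) !cls_mul mulA. Qed.

Definition quot : semigroup := MkSemigroup qmulA (inhabits (cls (word1 0))).

Lemma cls_hom : sg_hom (cls : F -> quot).
Proof. by move=> u v; rewrite -cls_mul. Qed.

Lemma eval_quot (phi : letter -> quot) w :
  eval phi w = cls (eval (fun x => rep (phi x)) w).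
Proof.
rewrite (hom_comp (S := F) (T := quot) _ _ cls_hom).
by apply: eval_in => x _; rewrite repK.
Qed.

(** An evaluation in the quotient lifts to a substitution, so full invariance
    makes [F/r] satisfy the identities in [r], and the identity substitution
    shows that it satisfies no others. *)
Lemma quot_sat u v : sg_sat quot u v <-> r u v.
Proof.
split=> [h|h phi]; last by rewrite !eval_quot; apply/clsE; apply: fic_subst.
apply/clsE; have E w : cls w = eval (fun x => cls (word1 x) : quot) w.
  by rewrite -(hom_comp (S := F) (T := quot) _ _ cls_hom) eval_word1.
by rewrite !E h.
Qed.

End Quotient.

(** * Joins of congruences and modularity *)

Inductive congr_join (r s : F -> F -> Prop) (a : F) : F -> Prop :=
| jn0 : congr_join r s a a
| jnS b c : congr_join r s a b -> r b c \/ s b c -> congr_join r s a c.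

Lemma jn_inv (P : F -> Prop) r s a c : congr_join r s a c -> P a ->
  (forall b d, P b -> r b d -> P d) -> (forall b d, P b -> s b d -> P d) -> P c.
Proof. by move=> h Pa hr hs; elim: h => // b d _ Pb []; [apply: hr | apply: hs]. Qed.

Lemma jn_fic r s : fully_invariant r -> fully_invariant s -> fully_invariant (congr_join r s).
Proof.
move=> fr fs.
have T a b c : congr_join r s a b -> congr_join r s b c -> congr_join r s a c.
  by move=> h k; apply: (jn_inv k) => // d e hd he;
    apply: jnS hd _; [left | right].
have L a b : r a b \/ s a b -> congr_join r s a b by move=> h; apply: jnS (jn0 _ _ _) h.
split=> //.
- exact: jn0.
- move=> a b; elim=> [|{}b c _ IH h]; first exact: jn0.
  by apply: T IH; apply: L; case: h => h; [left | right]; apply: fic_sym.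
- move=> a b c d h k; apply: (T _ (b ** c)).
    elim: h => [|x y _ IH h]; first exact: jn0.
    by apply: jnS IH _; case: h => h; [left | right]; apply: fic_mul => //; apply: fic_refl.
  elim: k => [|x y _ IH k]; first exact: jn0.
  by apply: jnS IH _; case: k => k; [left | right]; apply: fic_mul => //; apply: fic_refl.
- move=> f a b; elim=> [|x y _ IH h]; first exact: jn0.
  by apply: jnS IH _; case: h => h; [left | right]; apply: fic_subst.
Qed.

Lemma fic_meet r s : fully_invariant r -> fully_invariant s ->
  fully_invariant (fun a b => r a b /\ s a b).
Proof.
move=> [r1 r2 r3 r4 r5] [s1 s2 s3 s4 s5].
split=> [//|a b [? ?]|a b c [? ?] [? ?]|a b c d [? ?] [? ?]|f a b [? ?]]; split; eauto.
Qed.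

(** As for [sg_exp], the exponent is shifted: this is [x^(k+1)]. *)
Definition xpow (x : letter) (k : nat) : F := sg_exp (word1 x : F) k.

Lemma eval_xpow (S : semigroup) (phi : letter -> S) x k :
  eval phi (xpow x k) = sg_exp (phi x) k.
Proof. exact: (sg_hom_exp (@eval_hom S phi)). Qed.

Lemma letters_xpow x k : letters (xpow x k) = nseq k.+1 x.
Proof.
elim: k => // k IH; have -> : xpow x k.+1 = (word1 x : F) ** xpow x k by [].
by rewrite letters_mul IH.
Qed.

Lemma len_xpow x k : len (xpow x k) = k.+1.
Proof. by rewrite /len letters_xpow size_nseq. Qed.

Lemma word_le_xpow w x k : len w <= k.+1 -> word_le w (xpow x k).
Proof.
move=> h; apply/word_leP; exists (fun=> word1 x), (nseq (k.+1 - len w) x), [::].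
apply: letters_inj; rewrite letters_ctx letters_eval letters_xpow cats0 -[in LHS](subnK h).
rewrite nseqD; congr cat; rewrite /len; by elim: (letters w) => //= a s ->.
Qed.

Definition aperiodic (k : nat) (S : semigroup) : Prop :=
  forall x : S, sg_exp x k ** x = sg_exp x k.

(** The modular law is only tested on aperiodic varieties [Y] and [Z]. These
    become epigroup varieties when a power is taken as pseudoinverse, so that
    the property also follows for semigroup varieties that come from modular
    epigroup varieties. *)
Definition weakly_modular (V : SEM) : Prop := forall (k : nat) (Y Z : SEM),
  (forall S, Y S -> Z S) -> (forall S, Z S -> aperiodic k S) ->
  forall S, sem_join V Y S -> Z S -> sem_join (sem_meet V Z) Y S.

Lemma modular_weakly V : modular_element V -> weakly_modular V.
Proof.
move=> hV k Y Z YZ _ S VYS ZS.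
have /hV E : (Y <= Z)%O by apply/asboolP.
suff : (Order.join (Order.meet V Z) Y : SEM) S by [].
by rewrite -E.
Qed.

(** The modular law seen on theories. The free semigroup of the theory
    [(v /\ y) \/ z] lies in [(V \/ Y) /\ Z], hence in [(V /\ Z) \/ Y], and the
    latter satisfies all identities of [(v \/ z) /\ y]. *)
Lemma weakly_modular_theory V : weakly_modular V ->
  forall k (y z : F -> F -> Prop), fully_invariant y -> fully_invariant z ->
  (forall a b, z a b -> y a b) ->
  z (xpow 0 k ** word1 0) (xpow 0 k) ->
  forall a b, congr_join (sat V) z a b -> y a b ->
  congr_join (fun a b => sat V a b /\ y a b) z a b.
Proof.
move=> mV k y z fy fz zy zk a b vz yab.
have fr : fully_invariant (congr_join (fun a b => sat V a b /\ y a b) z).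
  by apply: jn_fic => //; apply: fic_meet => //; apply: sat_fic.
apply/(quot_sat fr); set Q := quot fr.
have QZ : Var z Q.
  by move=> u v h; apply/quot_sat; apply: jnS (jn0 _ _ _) _; right.
have QVY : sem_join V (Var y) Q.
  move=> X VX YX; apply: sg_birkhoff => u v Xuv; apply/quot_sat.
  apply: jnS (jn0 _ _ _) _; left; split; first by move=> S /VX; apply: Xuv.
  by apply/(quot_sat fy); apply: Xuv; apply: YX => c d /(quot_sat fy).
have ap S : Var z S -> aperiodic k S.
  by move=> h x; have /h/(_ (fun=> x)) := zk; rewrite evalM !eval_xpow.
have YZ S : Var y S -> Var z S by move=> h u v /zy/h.
have := mV k (Var y) (Var z) YZ ap Q QVY QZ.
move=> /(_ (Var (fun u v => u = a /\ v = b))); apply=> // S.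
  case=> VS ZS u v [-> ->].
  have fS := sg_sat_fic S.
  apply: (jn_inv (P := sg_sat S a) vz) => [phi //|c d h k'|c d h k'].
    exact: (fic_trans fS) h (k' S VS).
  exact: (fic_trans fS) h (ZS _ _ k').
by move=> h u v [-> ->]; apply: h.
Qed.

(** * Theories that collapse an ideal *)

Definition verbal_ideal (D : F -> Prop) : Prop :=
  forall p q (f : letter -> F) t, D t -> D (ctx p q (eval f t)).

(** The theories used as tests are generated by a few pairs of words and by the
    collapse of an ideal [D] of words that would otherwise be hard to control.
    They are built from single replacements in order to compute classes, see
    [gen_class]. *)
Definition gen_step (R : F -> F -> Prop) (D : F -> Prop) (t t' : F) : Prop :=
  (D t /\ D t') \/ exists p q (f : letter -> F) s s',
    [/\ R s s' \/ R s' s, t = ctx p q (eval f s) & t' = ctx p q (eval f s')].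

Inductive generated (R : F -> F -> Prop) (D : F -> Prop) (t : F) : F -> Prop :=
| gen0 : generated R D t t
| genS t' t'' : generated R D t t' -> gen_step R D t' t'' -> generated R D t t''.

Lemma gen_class (P : F -> Prop) R D t t' : generated R D t t' -> P t ->
  (forall t, P t -> ~ D t) ->
  (forall p q (f : letter -> F) s s', R s s' \/ R s' s ->
     P (ctx p q (eval f s)) -> P (ctx p q (eval f s'))) -> P t'.
Proof.
move=> h Pt PD PR; elim: h => // a b _ Pa [[/PD //]|[p [q [f [s [s' [h Ea ->]]]]]]].
by apply: PR h _; rewrite -Ea.
Qed.

Lemma gen1 R D s s' : R s s' -> generated R D s s'.
Proof.
move=> h; apply: genS (gen0 _ _ _) _; right; exists [::], [::], word1, s, s'.
by rewrite !ctx0 !eval_word1; split; [left|..].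
Qed.

Lemma gen_ideal R (D : F -> Prop) s s' : D s -> D s' -> generated R D s s'.
Proof. by move=> h h'; apply: genS (gen0 _ _ _) _; left. Qed.

Lemma gen_mono (R R' : F -> F -> Prop) D s s' : (forall a b, R a b -> R' a b) ->
  generated R D s s' -> generated R' D s s'.
Proof.
move=> h; elim=> [|a b _ IH hs]; first exact: gen0.
apply: genS IH _; case: hs => [|[p [q [f [t [t' [hR -> ->]]]]]]]; first by left.
by right; exists p, q, f, t, t'; split=> //; case: hR => /h; [left | right].
Qed.

Lemma gen_fic R D : verbal_ideal D -> fully_invariant (generated R D).
Proof.
move=> hD.
have T a b c : generated R D a b -> generated R D b c -> generated R D a c.
  by move=> h; elim=> // d e _ IH hs; apply: genS IH _.
have L a b : gen_step R D a b -> generated R D a b by move=> h; apply: genS (gen0 _ _ _) h.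
have Sc p q (f : letter -> F) a b : gen_step R D a b ->
    gen_step R D (ctx p q (eval f a)) (ctx p q (eval f b)).
  case=> [[Da Db]|[p' [q' [g [s [s' [h -> ->]]]]]]]; first by left; split; apply: hD.
  by right; rewrite !eval_ctx !ctx_ctx !eval_eval; do 5 eexists; split; first exact: h.
have Gc p q (f : letter -> F) a b : generated R D a b ->
    generated R D (ctx p q (eval f a)) (ctx p q (eval f b)).
  by elim=> [|d e _ IH hs]; [apply: gen0 | apply: genS IH (Sc _ _ _ _ _ hs)].
have cE p q a : ctx p q a = ctx p q (eval (word1 : letter -> F) a) by rewrite eval_word1.
split=> //.
- exact: gen0.
- move=> a b; elim=> [|c d _ IH hs]; first exact: gen0.
  apply: T IH; apply: L; case: hs => [[]|[p [q [f [s [s' [h -> ->]]]]]]]; first by left.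
  by right; exists p, q, f, s', s; split=> //; case: h; [right | left].
- move=> a b c d h k; apply: (T _ (b ** c)).
    have E e : e ** c = ctx [::] (letters c) e.
      by apply: letters_inj; rewrite letters_ctx.
    by rewrite !E cE (cE _ _ b); apply: Gc.
  have E e : b ** e = ctx (letters b) [::] e.
    by apply: letters_inj; rewrite letters_ctx cats0.
  by rewrite !E cE (cE _ _ d); apply: Gc.
- by move=> f a b h; rewrite -(ctx0 (eval f a)) -(ctx0 (eval f b)); apply: Gc.
Qed.

(** * Common suffixes *)

Lemma drop_le_cat (T : Type) n (s t : seq T) :
  n <= size s -> drop n (s ++ t) = drop n s ++ t.
Proof.
rewrite drop_cat leq_eqVlt => /predU1P[->|->] //.
by rewrite ltnn subnn drop0 drop_size.
Qed.

Definition common_suffix (I : F -> Prop) (t t' : F) : Prop :=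
  t = t' \/ exists s p p', [/\ I s, letters t = p ++ letters s & letters t' = p' ++ letters s].

(** Transitivity: of two suffixes of one word, one is a suffix of the other, and
    the shorter of them serves as a common suffix of all three words. *)
Lemma common_suffix_fic I : verbal_ideal I -> fully_invariant (common_suffix I).
Proof.
move=> hI; split.
- by left.
- by move=> a b [->|[s [p [p' [Is Ea Eb]]]]]; [left | right; exists s, p', p].
- move=> a b c [->//|[s [p [p' [Is Ea Eb]]]]] [<-|[t [q [q' [It Eb' Ec]]]]].
    by right; exists s, p, p'.
  have E := Eb; rewrite Eb' in E.
  right; have [le|/ltnW le] := leqP (size q) (size p').
    have Et : letters t = drop (size q) p' ++ letters s.
      by have := congr1 (drop (size q)) E; rewrite drop_size_cat // drop_le_cat.
    by exists s, p, (q' ++ drop (size q) p'); split=> //; rewrite Ec Et catA.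
  have Es : letters s = drop (size p') q ++ letters t.
    by have := congr1 (drop (size p')) E; rewrite drop_le_cat // drop_size_cat.
  by exists t, (p ++ drop (size p') q), q'; split=> //; rewrite Ea Es catA.
- move=> a b c d h k; apply: (@or_ind _ _ _ _ _ h) => {h} [<-|[s [p [p' [Is Ea Eb]]]]].
    case: k => [<-|[s [p [p' [Is Ec Ed]]]]]; first by left.
    right; exists s, (letters a ++ p), (letters a ++ p').
    by rewrite !letters_mul Ec Ed !catA.
  case: k => [<-|[t [q [q' [It Ec Ed]]]]].
    right; exists (s ** c), p, p'; rewrite !letters_mul Ea Eb !catA; split=> //.
    have -> : s ** c = ctx [::] (letters c) (eval (word1 : letter -> F) s).
      by apply: letters_inj; rewrite letters_ctx eval_word1.
    exact: hI.
  by right; exists t, (letters a ++ q), (letters b ++ q'); rewrite !letters_mul Ec Ed !catA.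
- move=> f a b [->|[s [p [p' [Is Ea Eb]]]]]; first by left.
  right; exists (eval f s), (flatten [seq letters (f x) | x <- p]),
    (flatten [seq letters (f x) | x <- p']).
  rewrite !letters_eval Ea Eb !map_cat !flatten_cat; split=> //.
  by rewrite -(ctx0 (eval f s)); apply: hI.
Qed.

Lemma word_le_verbal u : verbal_ideal (word_le u).
Proof. by move=> p q f t; apply: word_le_ctx. Qed.

(** The identity [u = w] turns the pair [(w, x w)] into [(u, x u)]. Identifying
    words with a common suffix in the ideal of multiples of [w] leaves [u] alone
    in its class; when multiples of [u] are added to the ideal, the class of
    [u] becomes the set of words that end with [u]. So a chain from [u] to [x u]
    has to begin with an identity [u = p u] of [V]. *)
Lemma left_multiple V u w : weakly_modular V -> sat V u w -> ~ word_le w u ->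
  exists p : F, sat V u (p ** u).
Proof.
move=> mV uw nwu; apply: contrapT => npu.
pose I t := word_le u t \/ word_le w t.
have hI : verbal_ideal I by move=> p q f t [h|h]; [left|right]; apply: word_le_verbal.
have fy := common_suffix_fic hI; have fz := common_suffix_fic (@word_le_verbal w).
have fv := sat_fic V.
have zy a b : common_suffix (word_le w) a b -> common_suffix I a b.
  by case=> [->|[s [p [p' [h1 h2 h3]]]]]; [left | right; exists s, p, p'; split=> //; right].
pose x : F := word1 0.
have zw : common_suffix (word_le w) w (x ** w).
  by right; exists w, [::], (letters x); rewrite letters_mul; split=> //; apply: word_le_refl.
have zk : common_suffix (word_le w) (xpow 0 (len w) ** word1 0) (xpow 0 (len w)).
  right; exists (xpow 0 (len w)), [:: 0], [::].
  split; [exact: word_le_xpow | | by []].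
  by rewrite letters_mul letters_xpow (_ : letters (word1 0) = nseq 1 0) // -nseqD addn1.
have vz : congr_join (sat V) (common_suffix (word_le w)) u (x ** u).
  apply: (jnS (b := x ** w)); last first.
    by left; apply: fic_mul fv _ _ _ _ (fic_refl fv _) (fic_sym fv uw).
  by apply: (jnS (b := w)); [apply: jnS (jn0 _ _ _) _; left | right].
have yu : common_suffix I u (x ** u).
  right; exists u, [::], (letters x); rewrite letters_mul; split=> //; left; exact: word_le_refl.
have := weakly_modular_theory mV fy fz zy zk vz yu.
suff H t : congr_join (fun a b => sat V a b /\ common_suffix I a b)
    (common_suffix (word_le w)) u t -> t = u.
  by move=> /H /(congr1 len); rewrite len_mul => /eqP; rewrite -{2}[len u]add0n eqn_add2r.
have suf s p : letters u = p ++ letters s -> word_le s u.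
  move=> E; apply/word_leP; exists word1, p, [::].
  by rewrite eval_word1; apply: letters_inj; rewrite letters_ctx cats0.
move=> h; apply: (jn_inv (P := fun t => t = u) h) => // b d -> {b h}.
  case=> ud [->//|[s [p [p' [Is Eu Ed]]]]].
  case: Is => hs; last by case: nwu; apply: word_le_trans hs (suf _ _ Eu).
  have Es : s = u.
    have := word_le_len hs; rewrite /len Eu size_cat -[leqRHS]add0n leq_add2r leqn0.
    by move=> /eqP/size0nil E; apply: letters_inj; rewrite Eu E.
  rewrite Es in Ed; case: p' Ed => [|y p'] Ed; first exact: letters_inj.
  case: npu; exists (y, p'); have <- : d = ((y, p') : F) ** u by apply: letters_inj.
  exact: ud.
case=> [->//|[s [p [p' [Is Eu Ed]]]]].
by case: nwu; apply: word_le_trans Is (suf _ _ Eu).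
Qed.

(** * Transposing letters of a word *)

Definition swp (x y z : letter) : letter :=
  if z == x then y else if z == y then x else z.

Lemma swpK x y : involutive (swp x y).
Proof.
move=> z; rewrite /swp; case: (eqVneq z x) => [->|nx].
  by rewrite eqxx; case: eqP.
case: (eqVneq z y) => [->|ny]; first by rewrite eqxx.
by rewrite (negPf nx) (negPf ny).
Qed.

Section Transpose.
Variables (u : F) (x y : letter).
Hypotheses (xu : x \in letters u) (yu : y \in letters u).

Let u' : F := rename (swp x y) u.

Definition csize (t : F) := size (undup (letters t)).

Lemma csize_rename g t : csize (rename g t) <= csize t.
Proof.
rewrite /csize letters_rename -(size_map g (undup (letters t))).
apply: uniq_leq_size (undup_uniq _) _ => z; rewrite mem_undup => /mapP[a ha ->].
by apply: map_f; rewrite mem_undup.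
Qed.

(** Once these words are collapsed, the only instances of [u] that survive are
    its renamings by maps that are injective on its letters. *)
Definition smaller_or_longer (t : F) : Prop :=
  len u < len t \/ len t = len u /\ csize t < csize u.

Local Notation D := smaller_or_longer.

Lemma smaller_or_longer_verbal : verbal_ideal D.
Proof.
move=> p q f t; have [h|h] := ltnP (len t) (len (ctx p q (eval f t))).
  case=> [h1|[E h1]]; left; first exact: ltn_trans h1 h.
  by rewrite -E.
have [g [-> _ _ _]] := ctx_eval_rename erefl h.
rewrite /D len_rename; case=> [h1|[E h1]]; [by left | right; split=> //].
exact: leq_ltn_trans (csize_rename _ _) h1.
Qed.

Lemma swp_mem : letters u' =i letters u.
Proof.
have sub z : z \in letters u -> swp x y z \in letters u.
  by rewrite /swp; case: eqP => // _; case: eqP.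
move=> z; rewrite letters_rename; apply/mapP/idP => [[a ha ->]|h]; first exact: sub.
by exists (swp x y z); rewrite ?swpK //; apply: sub.
Qed.

Lemma csize_mem (a b : F) : letters a =i letters b -> csize a = csize b.
Proof.
move=> h; apply/eqP; rewrite eqn_leq; apply/andP; split;
  apply: uniq_leq_size (undup_uniq _) _ => z; by rewrite !mem_undup h.
Qed.

Lemma not_D_u : ~ D u.
Proof. by case=> [|[_]]; rewrite ltnn. Qed.

Lemma not_D_u' : ~ D u'.
Proof. by rewrite /D len_rename (csize_mem swp_mem) !ltnn => -[|[_]]. Qed.

Definition swap_gen : F -> F -> Prop := generated (fun s s' => s = u /\ s' = u') D.
Definition collapse : F -> F -> Prop := generated (fun _ _ => False) D.

Lemma u'K : rename (swp x y) u' = u.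
Proof.
rewrite /u' rename_comp -[RHS]rename_id; apply/rename_in => z _ /=; exact: swpK.
Qed.

Lemma rename_agree g h s : rename g s = rename h s -> forall s' : F,
  letters s' =i letters s -> rename g s' = rename h s'.
Proof. by move=> /rename_in E s' hs; apply/rename_in => z; rewrite hs => /E. Qed.

Lemma swap_gen_class t : swap_gen u t -> t = u \/ t = u'.
Proof.
move=> h; apply: (gen_class (P := fun t => t = u \/ t = u') h).
- by left.
- by move=> s [->|->]; [apply: not_D_u | apply: not_D_u'].
have key g s s' : letters s' =i letters s ->
    rename g s = s -> rename g s' = s'.
  move=> hs E; rewrite -[RHS]rename_id; apply: (rename_agree _ hs); by rewrite rename_id.
move=> p q f s s' hR hP.
have [Es|Es] : (s = u /\ s' = u') \/ (s = u' /\ s' = u) by case: hR => -[-> ->]; [left|right].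
  case: Es hP => -> -> hP.
  have [|g [Eg -> -> hf]] := ctx_eval_rename (p := p) (q := q) (f := f) (s := u) erefl.
    by case: hP => ->; rewrite ?len_rename.
  have -> : eval f u' = rename g u'.
    by rewrite renameE; apply: eval_in => z; rewrite swp_mem => /hf.
  rewrite ctx0; case: hP; rewrite Eg => E.
    by right; apply: key E; apply: swp_mem.
  by left; rewrite -[RHS]u'K; apply: rename_agree E _ swp_mem.
case: Es hP => -> -> hP.
have [|g [Eg -> -> hf]] := ctx_eval_rename (p := p) (q := q) (f := f) (s := u') erefl.
  by case: hP => ->; rewrite ?len_rename.
have hm : letters u =i letters u' by move=> z; rewrite swp_mem.
have -> : eval f u = rename g u.
  by rewrite renameE; apply: eval_in => z; rewrite hm => /hf.
rewrite ctx0; case: hP; rewrite Eg => E; last by left; apply: key E.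
right; apply: rename_agree hm; by rewrite E u'K.
Qed.

Lemma collapse_class t : collapse u t -> t = u.
Proof.
move=> h; apply: (gen_class (P := fun t => t = u) h) => // [s ->|p q f s s' []] //.
exact: not_D_u.
Qed.

Lemma swap_gen_D t t' : swap_gen t t' -> D t' -> D t.
Proof.
move=> h Dt'; apply: contrapT => Dt.
apply: (gen_class (P := fun t => ~ D t) h) => //= p q f s s' hR hP.
have hm : letters s =i letters s' /\ (len s = len u /\ len s' = len u).
  by case: hR => -[-> ->]; rewrite !len_rename; split=> // z; rewrite swp_mem.
case: hm => hm [ls ls'].
have [|g [Eg -> -> hf]] := ctx_eval_rename (p := p) (q := q) (f := f) (s := s) erefl.
  by rewrite ls leqNgt; apply/negP => hlt; apply: hP; left.
move: hP; rewrite Eg ctx0.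
have -> : eval (f : letter -> F) s' = rename g s'.
  by rewrite renameE; apply: eval_in => z; rewrite -hm => /hf.
rewrite /D !len_rename ls ls' (csize_mem (a := rename g s') (b := rename g s)) // => z.
by rewrite !letters_rename; apply: esym; apply: eq_mem_map.
Qed.

Lemma collapse_swap a b : collapse a b -> swap_gen a b.
Proof. exact: gen_mono. Qed.

Lemma swap_gen_fic : fully_invariant swap_gen.
Proof. exact: gen_fic smaller_or_longer_verbal. Qed.

Lemma collapse_fic : fully_invariant collapse.
Proof. exact: gen_fic smaller_or_longer_verbal. Qed.

Lemma collapse_long a b : len u < len a -> len u < len b -> collapse a b.
Proof. by move=> ? ?; apply: gen_ideal; left. Qed.

Lemma swap_chain (v : F -> F -> Prop) : fully_invariant v ->
  congr_join (fun a b => v a b /\ swap_gen a b) collapse u u' -> v u u'.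
Proof.
move=> fv h; apply: contrapT => nv.
suff E : u' = u by apply: nv; rewrite E; apply: fic_refl.
apply: (jn_inv (P := fun t => t = u) h) => // b d -> {b}.
  by case=> vud /swap_gen_class[->|Ed] //; rewrite Ed in vud.
exact: collapse_class.
Qed.

End Transpose.

(** The longer word [w] is collapsed with its renaming, which links [u] to its
    renaming, while [u] is alone in its class of the collapsing theory. If also
    [u] and its renaming are identified, the class of [u] has no further
    elements, and the link must be an identity of [V]. *)
Lemma swap_of_longer V u w x y : weakly_modular V -> sat V u w -> len u < len w ->
  x \in letters u -> y \in letters u -> sat V u (rename (swp x y) u).
Proof.
move=> mV uw hlt xu yu; have fv := sat_fic V.
apply: swap_chain => //.
apply: (weakly_modular_theory (k := len u) mV) => //.
- exact: swap_gen_fic.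
- exact: collapse_fic.
- exact: collapse_swap.
- by apply: collapse_long; rewrite ?len_mul len_xpow // addn1 ltnS ltnW.
- apply: (jnS (b := rename (swp x y) w)); last first.
    left; rewrite !renameE; apply: (fic_subst fv); exact: (fic_sym fv).
  apply: (jnS (b := w)); first by apply: (jnS (jn0 _ _ _)); left.
  by right; apply: collapse_long; rewrite ?len_rename.
- exact: gen1.
Qed.

(** * Semigroups whose powers form a semilattice *)

Lemma sg_expS (S : semigroup) (x : S) n : sg_exp x n.+1 = x ** sg_exp x n.
Proof. by []. Qed.

Lemma sg_expSr (S : semigroup) (x : S) n : sg_exp x n.+1 = sg_exp x n ** x.
Proof. by rewrite sg_expS -sg_exp_comm. Qed.

Definition semilattice_powers (n : nat) (S : semigroup) : Prop :=
  [/\ aperiodic n S,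
      forall x y : S, sg_exp x n ** y = sg_exp x n ** sg_exp y n,
      forall x y : S, x ** sg_exp y n = sg_exp x n ** sg_exp y n,
      forall x y : S, sg_exp x n ** sg_exp y n = sg_exp y n ** sg_exp x n
    & forall x y : S, sg_exp (x ** y) n = sg_exp x n ** sg_exp y n].

Lemma aperiodic_idem (S : semigroup) n (x : S) : aperiodic n S ->
  sg_exp x n ** sg_exp x n = sg_exp x n.
Proof.
by move=> h; elim: {2}n => [|k IH]; [apply: h | rewrite sg_expSr mulA IH h].
Qed.

Lemma idem_exp (S : semigroup) n (e : S) : e ** e = e -> sg_exp e n = e.
Proof. by move=> h; elim: n => // n IH; rewrite sg_expS IH. Qed.

Lemma aperiodic_exp (S : semigroup) n (x : S) : aperiodic n S ->
  sg_exp (sg_exp x n) n = sg_exp x n.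
Proof. by move=> ap; apply/idem_exp/aperiodic_idem. Qed.

(** Idempotents [e = x^(n+1)] absorb their base and, by the two exchange
    identities, commute with everything; so [e y] only depends on the
    idempotent power of [y]. *)
Lemma semilattice_powers_of_exchange (S : semigroup) n : aperiodic n S ->
  (forall x y : S, sg_exp x n ** y = sg_exp y n ** x) ->
  (forall x y : S, y ** sg_exp x n = x ** sg_exp y n) ->
  semilattice_powers n S.
Proof.
move=> ap hG hH; pose f (x : S) := sg_exp x n.
have fE x : sg_exp x n = f x by [].
have fx x : f x ** x = f x by apply: ap.
have xf x : x ** f x = f x by rewrite /f -sg_exp_comm.
have ff x : f x ** f x = f x by apply: aperiodic_idem.
have f2 x : f (f x) = f x by apply: aperiodic_exp.
have hl x y : f x ** y = f y ** f x by rewrite -{1}(f2 x); apply: hG.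
have hr x y : y ** f x = f x ** f y by rewrite -{1}(f2 x); apply: hH.
have fC x y : f x ** f y = f y ** f x by rewrite hl f2.
have hfy x y : f x ** y = f x ** f y by rewrite hl fC.
have hyf x y : x ** f y = f x ** f y by rewrite hr fC.
split=> //; rewrite -/f => x y; rewrite !fE; set e := f (x ** y).
have ex z : e ** z = e ** f z by apply: hfy.
have eC z : e ** f z = f z ** e by apply: fC.
have exy : e ** x ** y = e by rewrite -mulA fx.
have e1 : e ** f x ** f y = e by rewrite -[RHS]exy (ex x) eC -!mulA (ex y).
have e2 : f x ** f y = f x ** e by rewrite -(hfy _ y) -(hfy _ (x ** y)) mulA fx.
by rewrite -(ff y) mulA e2 -eC e1.
Qed.

Lemma eval_absorb (S : semigroup) (phi : letter -> S) (w : word) x :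
  (forall x, phi x ** phi x = phi x) -> (forall x y, phi x ** phi y = phi y ** phi x) ->
  x \in letters w -> eval phi w ** phi x = eval phi w.
Proof.
move=> id cm; elim/word_ind: w => [y|w y IH]; first by rewrite inE => /eqP->; apply: id.
rewrite evalM (letters_mul w) mem_cat => /orP[/IH h|].
  by rewrite -mulA cm mulA h.
by rewrite inE => /eqP->; rewrite -mulA id.
Qed.

Lemma eval_content (S : semigroup) (phi : letter -> S) (v w : word) :
  (forall x, phi x ** phi x = phi x) -> (forall x y, phi x ** phi y = phi y ** phi x) ->
  letters v =i letters w -> eval phi v = eval phi w.
Proof.
move=> id cm vw.
have ab (a b : F) : {subset letters b <= letters a} -> eval phi a ** eval phi b = eval phi a.
  elim/word_ind: b => [x|b x IH] h; first by apply: eval_absorb => //; apply: h; rewrite inE.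
  rewrite evalM mulA IH; last by move=> y hy; apply: h; rewrite letters_mul mem_cat hy.
  by apply: eval_absorb => //; apply: h; rewrite letters_mul mem_cat orbC mem_head.
have C (a : F) x : eval phi a ** phi x = phi x ** eval phi a.
  elim/word_ind: a => [y|a y IH]; first exact: cm.
  by rewrite evalM -mulA [phi y ** phi x]cm mulA IH -mulA.
have CC (a b : F) : eval phi a ** eval phi b = eval phi b ** eval phi a.
  elim/word_ind: b => [y|b y IH]; first exact: C.
  by rewrite evalM mulA IH -!mulA; congr mul; apply: C.
have vw' : {subset letters w <= letters v} by move=> x; rewrite vw.
have wv' : {subset letters v <= letters w} by move=> x; rewrite vw.
by rewrite -[LHS](ab v w vw') -[RHS](ab w v wv') CC.
Qed.

Lemma SL_sat u v : letters u =i letters v <-> sat SL u v.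
Proof.
split=> [h S [id cm] phi|h]; first exact: eval_content.
pose S := @MkSemigroup bool orb orbA (inhabits true).
have SS : SL S by split; [apply: orbb | apply: orbC].
have E x w : eval (fun y => y == x : S) w = (x \in letters w).
  elim/word_ind: w => [y|w y IH]; first by rewrite inE eq_sym.
  by rewrite evalM (letters_mul w) mem_cat IH; congr orb; rewrite inE eq_sym.
by move=> x; rewrite -!E; apply: (h S SS (fun y => y == x)).
Qed.

(** * The decomposition of a variety with semilattice powers *)

Section Decomposition.
Variables (V : SEM) (n : nat).
Hypothesis hV : forall S, V S -> semilattice_powers n S.

Let nilrel (u v : F) : Prop :=
  v = xpow 0 n /\ (u = xpow 0 n ** (word1 1 : F) \/ u = (word1 1 : F) ** xpow 0 n).

Definition nil_part : SEM := sem_meet V (Var nilrel).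

Lemma nil_partP S : nil_part S <->
  V S /\ forall x y : S, sg_exp x n ** y = sg_exp x n /\ y ** sg_exp x n = sg_exp x n.
Proof.
split=> -[VS h]; split=> //.
  move=> x y; pose phi (i : letter) := if i == 0 then x else y.
  have h1 := h _ _ (conj erefl (or_introl erefl)) phi.
  have h2 := h _ _ (conj erefl (or_intror erefl)) phi.
  by move: h1 h2; rewrite !evalM !eval_xpow.
by move=> u v [-> [->|->]] phi; rewrite !evalM !eval_xpow; case: (h (phi 0) (phi 1)).
Qed.

Lemma nil_part_nil : nil_variety nil_part.
Proof.
move=> S /nil_partP[VS h]; case: (carrier_inhabited S) => x0.
exists (sg_exp x0 n); split=> [x|x]; first exact: h.
exists n; have [<- _] := h x (sg_exp x0 n); exact: (h x0 (sg_exp x n)).2.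
Qed.

(** [powered a]: the word [a] takes its values among the idempotents. *)
Let powered (a : F) := sat V a (sg_exp a n).

Let powered_content p q : powered p -> powered q -> letters p =i letters q -> sat V p q.
Proof.
move=> hp hq pq S VS phi; have [ap h1 h2 h3 h4] := hV VS.
have fh : sg_hom (fun x : S => sg_exp x n) by move=> x y; apply: h4.
have E a : powered a -> eval phi a = eval (fun x => sg_exp (phi x) n) a.
  by move=> ha; rewrite (ha S VS) (sg_hom_exp (@eval_hom S phi)) (hom_comp _ _ fh).
rewrite (E p) // (E q) //; apply: eval_content => [x|x y|//]; last exact: h3.
exact: (aperiodic_idem _ ap).
Qed.

(** The theory of the nil part identifies two words when [V] does so or when
    both only take idempotent values; idempotent values depend on the content
    of a word alone. *)
Lemma sat_nil_part p q : (forall a b, sat V a b -> letters a =i letters b) ->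
  sat nil_part p q -> letters p =i letters q -> sat V p q.
Proof.
move=> hc hpq c; have fv := sat_fic V.
have pe a b : sat V a b -> powered a -> powered b.
  move=> ab ha S VS phi; rewrite -(ab S VS phi) (ha S VS) !(sg_hom_exp (@eval_hom S phi)).
  by rewrite (ab S VS phi).
have pM a b : powered a \/ powered b -> powered (a ** b).
  move=> h S VS phi; have [ap h1 h2 h3 h4] := hV VS.
  rewrite (sg_hom_exp (@eval_hom S phi)) !evalM h4.
  case: h => h; rewrite (h S VS) (sg_hom_exp (@eval_hom S phi)).
    by rewrite h1 aperiodic_exp.
  by rewrite h2 aperiodic_exp.
(* [r] is the theory of the nil part. *)
pose r a b := sat V a b \/ powered a /\ powered b.
have fr : fully_invariant r.
  split.
  - by move=> a; left; apply: fic_refl.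
  - by move=> a b [h|[? ?]]; [left; apply: (fic_sym fv) | right].
  - move=> a b d [h|[ha hb]] [k|[k1 k2]].
    + by left; apply: (fic_trans fv) h k.
    + by right; split=> //; apply: pe k1; apply: (fic_sym fv).
    + by right; split=> //; apply: pe hb.
    + by right.
  - move=> a b d e [h|[ha hb]] [k|[hd he]]; last 3 first.
    + by right; split; apply: pM; right.
    + by right; split; apply: pM; left.
    + by right; split; apply: pM; left.
    + by left; apply: (fic_mul fv).
  - move=> f a b [h|[ha hb]]; first by left; apply: (fic_subst fv).
    by right; split; rewrite /powered -(sg_hom_exp (@eval_hom F f)); apply: (fic_subst fv).
have rN : nil_part (quot fr).
  split.
    by apply: sg_birkhoff => a b ab; apply/quot_sat; left.
  have px : powered (xpow 0 n).
    move=> S VS phi; have [ap _ _ _ _] := hV VS.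
    by rewrite (sg_hom_exp (@eval_hom S phi)) eval_xpow aperiodic_exp.
  move=> u w [-> hu]; apply/quot_sat; right; split=> //.
  by case: hu => ->; apply: pM; [left | right].
case: (proj1 (quot_sat fr p q) (hpq _ rN)) => // -[hp hq].
exact: powered_content.
Qed.

(** Evaluating [x] to an idempotent [f] and the other letters to an idempotent
    [e] yields [e = e f] by absorption, so by symmetry all idempotents coincide
    and their common value is a zero. *)
Lemma nil_part_all p q x : sat V p q -> x \in letters p -> x \notin letters q ->
  forall S, V S -> nil_part S.
Proof.
move=> hpq xp xq S VS; apply/nil_partP; split=> //; have [ap h1 h2 h3 h4] := hV VS.
have ii := @aperiodic_idem S n _ ap.
have le (s t : S) : sg_exp s n = sg_exp s n ** sg_exp t n.
  pose phi (y : letter) := sg_exp (if y == x then t else s) n.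
  have Eq : eval phi q = sg_exp s n.
    rewrite (eval_in (psi := fun=> sg_exp s n)) => [|y hy]; last first.
      by rewrite /phi; case: eqP => // E; rewrite -E hy in xq.
    by elim/word_ind: q {hpq xq} => // q y IH; rewrite evalM IH ii.
  have := eval_absorb (phi := phi) (fun y => ii _) (fun y z => h3 _ _) xp.
  by rewrite (hpq S VS) Eq /phi eqxx => ->.
have eqf (s t : S) : sg_exp s n = sg_exp t n by rewrite (le s t) h3 -le.
by move=> s t; split; [rewrite h1 | rewrite h2]; rewrite (eqf t s) ii.
Qed.

Theorem semilattice_powers_decomposition :
  exists M N : SEM, [/\ M = SEM_T \/ M = SL, nil_variety N, V = Order.join M N
    & forall p q, letters p =i letters q -> sat N p q -> sat V p q].
Proof.
have NV S : nil_part S -> V S by case.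
have jE (M : SEM) : (forall S, M S -> V S) ->
    (forall a b, sat M a b -> sat nil_part a b -> sat V a b) ->
    V = Order.join M nil_part.
  move=> MV h; apply: SEM_ext => S; change (V S <-> sem_join M nil_part S).
  split=> [VS X MX NX|/(_ V MV NV)]; last exact.
  by apply: sg_birkhoff => a b ab; apply: h VS => T /[dup]; [move=> /MX | move=> /NX];
    move=> XT _; apply: ab.
have [hc|nc] := pselect (forall a b, sat V a b -> letters a =i letters b).
  exists SL, nil_part; split; [by right|exact: nil_part_nil| |].
    apply: jE => [S SS|a b /SL_sat ab nab]; last exact: sat_nil_part.
    by apply: sg_birkhoff => a b /hc/SL_sat; apply.
  by move=> p q pq hpq; apply: sat_nil_part.
have {nc} [p [q [x [hpq xp xq]]]] : exists p q x,
    [/\ sat V p q, x \in letters p & x \notin letters q].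
  apply: contrapT => h; apply: nc => a b ab x; apply/idP/idP => hx; apply/negPn/negP => hn.
    by apply: h; exists a, b, x.
  by apply: h; exists b, a, x; split=> //; apply: (fic_sym (sat_fic V)) ab.
have VN := nil_part_all hpq xp xq.
exists SEM_T, nil_part; split; [by left|exact: nil_part_nil| |].
  apply: jE => [S hS|a b _ nab S VS]; last exact: nab (VN S VS).
  by apply: sg_birkhoff => a b _ phi; apply: hS.
by move=> a b _ nab S VS; apply: nab (VN S VS).
Qed.

End Decomposition.

(** * Semilattice powers from letter transpositions *)

Definition swaps (v : F -> F -> Prop) (m : nat) : Prop :=
  forall p q x y, let u := ctx p q (xpow 0 m) in
  x \in letters u -> y \in letters u -> v u (rename (swp x y) u).

(** With [X = x^(m+1)] and [Y = y^(m+1)] one has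
    [X x y = X y x = Y x x = X y y]. For [y = x x] this equates [X x x x] with
    [X x x x x], so the semigroup is aperiodic. *)
Lemma swaps_semilattice_powers (S : semigroup) m :
  swaps (sg_sat S) m -> semilattice_powers m.+3 S.
Proof.
move=> hs; pose ph (x y z : S) (i : letter) := if i == 0 then x else if i == 1 then y else z.
have key (p q : seq letter) a b x y z :
    let u := ctx p q (xpow 0 m) in a \in letters u -> b \in letters u ->
    eval (ph x y z) u = eval (fun i => ph x y z (swp a b i)) u.
  by move=> u ha hb; rewrite (hs p q a b ha hb) eval_rename.
have in0 p q : 0 \in letters (ctx p q (xpow 0 m)).
  by rewrite letters_ctx letters_xpow !mem_cat mem_head orbT.
have inq p q (x : letter) : x \in q -> x \in letters (ctx p q (xpow 0 m)).
  by move=> h; rewrite letters_ctx !mem_cat h !orbT.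
have inp p q (x : letter) : x \in p -> x \in letters (ctx p q (xpow 0 m)).
  by move=> h; rewrite letters_ctx !mem_cat h.
have E1 y q : ctx [::] (y :: q) (xpow 0 m) = xpow 0 m ** ((y, q) : F).
  by apply: letters_inj; rewrite letters_ctx.
have E2 y p : ctx (y :: p) [::] (xpow 0 m) = ((y, p) : F) ** xpow 0 m.
  by apply: letters_inj; rewrite letters_ctx letters_mul cats0.
have hA (x y z : S) : sg_exp x m ** y ** z = sg_exp x m ** z ** y.
  have := key [::] [:: 1; 2] 1 2 x y z (inq [::] [:: 1; 2] 1 isT) (inq [::] [:: 1; 2] 2 isT).
  by rewrite E1 !evalM !eval_xpow /= !mulA.
have hB (x y z : S) : sg_exp x m ** y ** z = sg_exp y m ** x ** z.
  have := key [::] [:: 1; 2] 0 1 x y z (in0 _ _) (inq [::] [:: 1; 2] 1 isT).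
  by rewrite E1 !evalM !eval_xpow /= !mulA.
have hD (x y : S) : sg_exp x m ** y ** y = sg_exp y m ** x ** x.
  have := key [::] [:: 1; 1] 0 1 x y y (in0 _ _) (inq [::] [:: 1; 1] 1 isT).
  by rewrite E1 !evalM !eval_xpow /= !mulA.
have hE (x y : S) : sg_exp x m ** x ** y = sg_exp x m ** y ** y by rewrite hA hB -hD.
have hG (x y : S) : sg_exp x m.+3 ** y = sg_exp y m.+3 ** x.
  have h := key [::] [:: 0; 0; 0; 1] 0 1 x y y (in0 _ _) (inq [::] [:: 0; 0; 0; 1] 1 isT).
  by rewrite E1 !evalM !eval_xpow /= !mulA in h; rewrite !sg_expSr.
have hH (x y : S) : y ** sg_exp x m.+3 = x ** sg_exp y m.+3.
  have h := key [:: 1; 0; 0; 0] [::] 0 1 x y y (in0 _ _) (inp [:: 1; 0; 0; 0] [::] 1 isT).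
  by rewrite E2 !evalM !eval_xpow /= in h; rewrite !sg_expS !mulA.
apply: semilattice_powers_of_exchange => // x.
by have := hE x (x ** x); rewrite !mulA -!sg_expSr.
Qed.

(** * Words that are equal to zero *)

Definition is_zero (S : semigroup) (z : S) : Prop := forall x, z ** x = z /\ x ** z = z.

Lemma is_zero_uniq (S : semigroup) (z z' : S) : is_zero z -> is_zero z' -> z = z'.
Proof. by move=> h h'; have [<- _] := h z'; case: (h' z). Qed.

Lemma eval_zero (S : semigroup) (z : S) phi (u : word) x :
  is_zero z -> x \in letters u -> phi x = z -> eval phi u = z.
Proof.
move=> hz xu E; elim/word_ind: u xu => [y|u y IH].
  by rewrite inE => /eqP Ex; rewrite -E Ex.
rewrite (letters_mul u) mem_cat evalM => /orP[/IH->|]; first by case: (hz (phi y)).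
rewrite inE => /eqP Ex; have -> : eval phi (word1 y) = z by rewrite -E Ex.
by case: (hz (eval phi u)).
Qed.

Lemma fresh_letter (u : word) : exists x, x \notin letters u.
Proof.
exists (\max_(i <- letters u) i).+1; apply/negP => h.
by have := leq_bigmax_seq (P := predT) (F := id) _ h isT; rewrite ltnn.
Qed.

Section Zero.
Variable N : SEM.
Hypothesis nilN : nil_variety N.

Lemma nil_zero S : N S -> exists z : S, is_zero z.
Proof. by move=> /nilN[z [hz _]]; exists z. Qed.

Lemma sat0P u : sat0 N u <->
  forall S, N S -> forall z : S, is_zero z -> forall phi, eval phi u = z.
Proof.
split=> [h S NS z hz phi|h x xu].
  have [x xu] := fresh_letter u; have [/(_ S NS) E _] := h x xu.
  pose psi y := if y == x then z else phi y.
  have := E psi; rewrite evalM (_ : eval psi (word1 x) = z); last by rewrite /eval /= /psi eqxx.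
  rewrite (hz _).2 => ->; apply: eval_in => y yu.
  by rewrite /psi; case: eqP => // Ey; rewrite -Ey yu in xu.
split=> S NS phi; have [z hz] := nil_zero NS;
  by rewrite evalM (h S NS z hz) ?(hz _).1 ?(hz _).2.
Qed.

Lemma sat0_sat u v : sat0 N u -> sat N u v -> sat0 N v.
Proof.
by move=> /sat0P h uv; apply/sat0P => S NS z hz phi; rewrite -(uv S NS) (h S NS z hz).
Qed.

Lemma sat0_content u v x : sat N u v -> x \in letters u -> x \notin letters v ->
  sat0 N u /\ sat0 N v.
Proof.
move=> uv xu xv; suff h : sat0 N v.
  by split=> //; apply: sat0_sat h _; apply: (fic_sym (sat_fic N)).
apply/sat0P => S NS z hz phi; pose psi y := if y == x then z else phi y.
have <- : eval psi v = eval phi v.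
  by apply: eval_in => y yv; rewrite /psi; case: eqP => // E; rewrite -E yv in xv.
by rewrite -(uv S NS); apply: eval_zero hz xu _; rewrite /psi eqxx.
Qed.

(** Iterating gives [u = p^n u], and [p] is nilpotent. *)
Lemma sat0_left_multiple u (p : F) : sat N u (p ** u) -> sat0 N u.
Proof.
move=> h; apply/sat0P => S NS z hz phi.
have [z' [hz' nil]] := nilN NS; have Ez := is_zero_uniq hz' hz; rewrite Ez in nil.
have [n hn] := nil (eval phi p).
suff -> : eval phi u = sg_exp (eval phi p) n ** eval phi u by rewrite hn; case: (hz (eval phi u)).
elim: n {hn} => [|n IH]; first by rewrite /sg_exp /= -evalM; apply: h.
by rewrite sg_expS -mulA -IH -evalM; apply: h.
Qed.

End Zero.

(** * Permutations of the letters of a word *)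

Section Action.
Variables (T : finType) (e : T -> letter).
Hypothesis inj_e : injective e.

Lemma perm_word1 u : perm_word e 1%g u = u.
Proof. by rewrite -[RHS]rename_id; apply/rename_in => x _; apply: perm_letter1. Qed.

Lemma perm_wordM s t u : perm_word e (s * t)%g u = perm_word e t (perm_word e s u).
Proof. by rewrite /perm_word rename_comp; apply/rename_in => x _; apply: perm_letterM. Qed.

Lemma perm_wordK s u : perm_word e s^-1%g (perm_word e s u) = u.
Proof. by rewrite -perm_wordM mulgV perm_word1. Qed.

Lemma perm_wordKV s u : perm_word e s (perm_word e s^-1%g u) = u.
Proof. by rewrite -perm_wordM mulVg perm_word1. Qed.

Lemma perm_word_le s u : word_le u (perm_word e s u) /\ word_le (perm_word e s u) u.
Proof.
split; first exact: word_le_rename.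
by rewrite -{2}(perm_wordK s u); apply: word_le_rename.
Qed.

Lemma fic_perm_word (r : F -> F -> Prop) s u v : fully_invariant r -> r u v ->
  r (perm_word e s u) (perm_word e s v).
Proof. by move=> fr; rewrite /perm_word !renameE; apply: fic_subst. Qed.

Section Content.
Variable u : word.
Hypothesis cu : codom e =i letters u.

Lemma perm_word_letters s : letters (perm_word e s u) =i letters u.
Proof.
move=> x; rewrite letters_rename -cu; apply/mapP/codomP => [[y]|[i ->]].
  by rewrite -cu => /codomP[i ->] ->; exists (s i); rewrite perm_letterE.
by exists (e (s^-1%g i)); rewrite ?perm_letterE ?permKV // -cu codom_f.
Qed.

Lemma perm_word_inj s t : perm_word e s u = perm_word e t u -> s = t.
Proof.
move=> /rename_in h; apply/permP => i; apply: inj_e.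
by rewrite -!(perm_letterE inj_e); apply: h; rewrite -cu codom_f.
Qed.

Lemma rename_perm f : letters (rename f u) =i letters u ->
  exists s : {perm T}, rename f u = perm_word e s u.
Proof.
move=> h.
have /choice[g hg] i : exists j, e j = f (e i).
  suff /codomP[j ->] : f (e i) \in codom e by exists j.
  by rewrite cu -h letters_rename map_f // -cu codom_f.
have /choice[k hk] j : exists i, g i = j.
  have : e j \in letters (rename f u) by rewrite h -cu codom_f.
  rewrite letters_rename => /mapP[x]; rewrite -cu => /codomP[i ->] E.
  by exists i; apply: inj_e; rewrite hg.
have injk : injective k by apply: can_inj hk.
have injg : injective g.
  have [k' kk' k'k] := injF_bij injk.
  by apply: (can_inj (g := k)) => i; rewrite -[i in LHS]k'k hk k'k.
exists (perm injg); apply/rename_in => x; rewrite -cu => /codomP[i ->].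
by rewrite perm_letterE // permE hg.
Qed.

End Content.

Lemma stab_rel_group (r : F -> F -> Prop) u : fully_invariant r ->
  group_set [set s : {perm T} | `[< r u (perm_word e s u) >]].
Proof.
move=> fr; apply/group_setP; split=> [|s t].
  by rewrite inE; apply/asboolP; rewrite perm_word1; apply: fic_refl.
rewrite !inE => /asboolP hs /asboolP ht; apply/asboolP; rewrite perm_wordM.
exact: (fic_trans fr) ht (fic_perm_word t fr hs).
Qed.

Lemma mem_stab N s u : (s \in stab N e u) <-> sat N u (perm_word e s u).
Proof. by rewrite inE; split=> /asboolP. Qed.

Lemma stab_conj N s t u : s \in stab N e u ->
  (s ^ t)%g \in stab N e (perm_word e t u).
Proof.
move=> /mem_stab h; apply/mem_stab; rewrite -perm_wordM -conjgC perm_wordM.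
exact: fic_perm_word (sat_fic N) h.
Qed.

(** * Linking the orbits of two words *)

Section Link.
Variables (u v : F) (cu : codom e =i letters u) (cv : codom e =i letters v).
Hypothesis uv : u = v \/ incomparable u v.

(** Collapsing these words keeps the classes of [u] and [v] inside their
    orbits under renaming. *)
Definition properly_above (t : F) : Prop :=
  (word_le u t /\ ~ word_le t u) \/ (word_le v t /\ ~ word_le t v).

Definition link_gen (B : {group {perm T}}) (s s' : F) : Prop :=
  s = u /\ (s' = v \/ exists2 b, b \in B & s' = perm_word e b u).

Definition link (B : {group {perm T}}) : F -> F -> Prop := generated (link_gen B) properly_above.

Definition link_orbit (B : {group {perm T}}) (t : F) : Prop :=
  exists2 b, b \in B & t = perm_word e b u \/ t = perm_word e b v.

Lemma properly_above_verbal : verbal_ideal properly_above.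
Proof.
move=> p q f t; have le : word_le t (ctx p q (eval f t)).
  exact: word_le_ctx (word_le_refl t).
by case=> -[h nh]; [left | right]; (split; first exact: word_le_ctx) => h';
  apply: nh; apply: word_le_trans le h'.
Qed.

Lemma link_fic B : fully_invariant (link B).
Proof. exact: gen_fic properly_above_verbal. Qed.

Lemma link_mono (A B : {group {perm T}}) : A \subset B ->
  forall a b, link A a b -> link B a b.
Proof.
move=> sAB a b; apply: gen_mono => s s' [-> [->|[c cA ->]]]; split=> //; first by left.
by right; exists c => //; apply: (subsetP sAB).
Qed.

Lemma link_uv B : link B u v.
Proof. by apply: gen1; split=> //; left. Qed.

Lemma link_u (B : {group {perm T}}) b : b \in B -> link B u (perm_word e b u).
Proof. by move=> hb; apply: gen1; split=> //; right; exists b. Qed.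

Lemma link_aperiodic B : exists k, link B (xpow 0 k ** word1 0) (xpow 0 k).
Proof.
exists (len u); have h k : len u <= k -> properly_above (xpow 0 k).
  move=> hk; left; split; first by apply: word_le_xpow; apply: leqW.
  by move=> /word_le_len; rewrite len_xpow leqNgt ltnS hk.
apply: gen_ideal; last exact: h.
have -> : xpow 0 (len u) ** word1 0 = xpow 0 (len u).+1 by rewrite /xpow sg_expSr.
exact: h.
Qed.

Let above_orbit B t : link_orbit B t -> ~ properly_above t.
Proof.
move=> [b _ ht]; have lu := perm_word_le b u; have lv := perm_word_le b v.
case: uv ht => [E|[n1 n2]]; first by rewrite -E => -[->|->] [] [_]; rewrite -?E; case: lu.
case=> -> [] [h1 h2].
- by apply: h2; case: lu.
- by apply: n2; apply: word_le_trans h1 _; case: lu.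
- by apply: n1; apply: word_le_trans h1 _; case: lv.
- by apply: h2; case: lv.
Qed.

(** A replacement that stays within the lengths of [u] and [v] has no context
    and acts by a permutation from [B]; incomparability excludes that an
    instance of one of the words occurs in the orbit of the other. *)
Lemma link_class B t t' : link_orbit B t -> link B t t' -> link_orbit B t'.
Proof.
move=> ht h; apply: (gen_class h ht) => [s|p q f s s' hR]; first exact: above_orbit.
have ou : link_orbit B u by exists 1%g => //; left; rewrite perm_word1.
have ov : link_orbit B v by exists 1%g => //; right; rewrite perm_word1.
have [os os'] : link_orbit B s /\ link_orbit B s'.
  have ob b : b \in B -> link_orbit B (perm_word e b u) by move=> hb; exists b => //; left.
  by case: hR => -[-> [->|[b hb ->]]]; split=> //; apply: ob.
have cs' : codom e =i letters s'.
  by case: os' => b _ [] -> x; rewrite perm_word_letters.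
have main (w : F) a b : codom e =i letters w -> a \in B -> b \in B ->
    s = perm_word e a w -> ctx p q (eval f s) = perm_word e b w ->
    link_orbit B (ctx p q (eval f s')).
  move=> cw ha hb Es Ec.
  have [|g [Eg -> -> hf]] := ctx_eval_rename (p := p) (q := q) (f := f) (s := s) erefl.
    by rewrite Ec Es !len_rename.
  have cs : codom e =i letters s by move=> x; rewrite Es perm_word_letters.
  rewrite ctx0; have -> : eval (f : letter -> F) s' = rename g s'.
    by rewrite renameE; apply: eval_in => x; rewrite -cs' cs => /hf.
  have -> : rename g s' = perm_word e (a^-1 * b)%g s'.
    have E : rename g s = perm_word e (a^-1 * b)%g s.
      by rewrite -Eg Ec Es perm_wordM perm_wordK.
    by apply/rename_in => x; rewrite -cs' cs; move/rename_in: E => /[apply].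
  case: os' => c hc [] ->; exists (c * (a^-1 * b))%g; rewrite ?groupM ?groupV //;
    by rewrite -perm_wordM; first [by left | by right].
case: os => a ha hs [b hb hb'].
have cross (w w' : F) : s = perm_word e a w -> ctx p q (eval f s) = perm_word e b w' ->
    word_le w w'.
  move=> Es Ec; apply: word_le_trans (_ : word_le (ctx p q (eval f s)) w').
    by apply: word_le_ctx; rewrite Es; case: (perm_word_le a w).
  by rewrite Ec; case: (perm_word_le b w').
case: hs hb' => Es [] Ec.
- exact: (main u a b).
- case: uv => [E|[nuv _]]; first by apply: (main u a b) => //; rewrite E.
  by case: nuv; apply: cross Es Ec.
- case: uv => [E|[_ nvu]]; first by apply: (main u a b) => //; rewrite E.
  by case: nvu; apply: cross Es Ec.
- exact: (main v a b).
Qed.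

End Link.
End Action.

(** * Zero words and modular stabilizers *)

Section Conditions.
Variables V N : SEM.
Hypotheses (mV : weakly_modular V) (nilN : nil_variety N).
Hypothesis VN : forall p q, sat V p q -> sat N p q.
Hypothesis NV : forall p q, letters p =i letters q -> sat N p q -> sat V p q.

Lemma satN_incomparable u v : sat V u v -> ~ word_le v u -> sat0 N u /\ sat0 N v.
Proof.
move=> uv /(left_multiple mV uv)[p /VN/(sat0_left_multiple nilN) h].
by split=> //; apply: sat0_sat nilN _ _ h (VN uv).
Qed.

Lemma renaming_substitutive u f : letters u =i letters (rename f u) ->
  substitutive u (rename f u).
Proof.
move=> h; split=> //; apply: rename_perm; first exact: alph_val_inj.
  move=> x; apply/codomP/idP => [[i ->]|hx]; first exact: valP.
  by exists (SeqSub hx).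
by move=> x; rewrite h.
Qed.

(** Words that are below each other are renamings of each other. Otherwise
    [left_multiple] applies to one of the two words and makes it zero. *)
Lemma condition_aP : condition_a N.
Proof.
move=> u v ns uv; have vu := fic_sym (sat_fic N) uv.
have [c|nc] := pselect (letters u =i letters v); last first.
  have [x hx] : exists x, (x \in letters u) != (x \in letters v).
    by apply: contrapT => h; apply: nc => x; apply/eqP/negPn/negP => hx; apply: h; exists x.
  have [xu|xu] := boolP (x \in letters u).
    have xv : x \notin letters v by move: hx; rewrite xu; case: (x \in letters v).
    exact: (sat0_content nilN uv xu xv).
  have xv : x \in letters v by move: hx; rewrite (negPf xu); case: (x \in letters v).
  by have [] := sat0_content nilN vu xv xu.
have uvV := NV c uv; have vuV := fic_sym (sat_fic V) uvV.
have [le1|] := pselect (word_le v u); last exact: satN_incomparable.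
have [le2|/(satN_incomparable vuV)[]//] := pselect (word_le u v).
have [f Ef] := word_le_antisym le2 le1; case: ns.
by rewrite Ef in c *; apply: renaming_substitutive.
Qed.

Section Stabilizers.
Variables (T : finType) (e : T -> letter).
Hypothesis inj_e : injective e.

Lemma sat_orbit u t : codom e =i letters u -> ~ sat0 N u -> sat V u t ->
  exists2 s, s \in stab N e u & t = perm_word e s u.
Proof.
move=> cu nu ut; have utN := VN ut.
have [c [s Es]] : substitutive u t.
  by apply: contrapT => ns; case: (condition_aP ns utN).
have [|s' Es'] := rename_perm inj_e cu (f := perm_letter (alph_val (u := u)) s).
  by move=> x; rewrite c Es.
by exists s'; [apply/mem_stab; rewrite -Es' -[rename _ _]Es | rewrite -Es'].
Qed.

Lemma stab_sat u s : codom e =i letters u -> s \in stab N e u -> sat V u (perm_word e s u).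
Proof. by move=> cu /mem_stab h; apply: NV h => x; rewrite perm_word_letters. Qed.

Lemma stab_sat0 u : sat0 N u -> stab N e u = [set: {perm T}].
Proof.
move=> /(sat0P nilN) h; apply/setP => s; rewrite [RHS]inE; apply/mem_stab => S NS phi.
by have [z hz] := nil_zero nilN NS; rewrite eval_rename !(h S NS z hz).
Qed.

Local Notation H := (stab_group N inj_e).

(** The theories that identify the words of the [A]-orbit of [u], for a group
    [A] of permutations of letters, reproduce inside the lattice of varieties
    the modular law for the stabilizer. *)
Lemma stab_modular u (A B : {group {perm T}}) g : codom e =i letters u -> ~ sat0 N u ->
  A \subset B -> g \in (H u <*> A)%G -> g \in B -> g \in ((H u :&: B) <*> A)%G.
Proof.
move=> cu nu sAB gHA gB.
have uu : u = u \/ incomparable u u by left.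
pose z := link e u u A; pose y := link e u u B.
have fz : fully_invariant z := link_fic e u u A.
have fy : fully_invariant y := link_fic e u u B.
have fv := sat_fic V.
have [k zk] := link_aperiodic e u u A.
have vz : congr_join (sat V) z u (perm_word e g u).
  have fj := jn_fic fv fz.
  suff : g \in Group (stab_rel_group inj_e u fj) by rewrite inE => /asboolP.
  apply: subsetP gHA; rewrite join_subG; apply/andP; split; apply/subsetP => s hs;
    rewrite inE; apply/asboolP; apply: jnS (jn0 _ _ _) _.
    by left; apply: stab_sat.
  by right; apply: link_u.
have yg : y u (perm_word e g u) by apply: link_u.
have := weakly_modular_theory mV fy fz (link_mono sAB) zk vz yg.
set L := (_ <*> _)%G => h.
have sLB : L \subset B by rewrite join_subG subsetIr.
suff [s sL E] : exists2 s, s \in L & perm_word e g u = perm_word e s u.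
  by rewrite (perm_word_inj inj_e cu E).
have cls (C : {group {perm T}}) t : link e u u C u t -> exists2 s, s \in C & t = perm_word e s u.
  move=> ht; have [] := link_class inj_e cu cu uu _ ht.
    by exists 1%g => //; left; rewrite perm_word1.
  by move=> s sC [] ->; exists s.
have back (r : F -> F -> Prop) s t : fully_invariant r -> r (perm_word e s u) t ->
    r u (perm_word e s^-1%g t).
  by move=> fr /(fic_perm_word e s^-1%g fr); rewrite perm_wordK.
apply: (jn_inv (P := fun t => exists2 s, s \in L & t = perm_word e s u) h).
- by exists 1%g => //; rewrite perm_word1.
- move=> b d [s sL ->] [/(back _ _ _ fv)/(sat_orbit cu nu)[t tH Et] /(back _ _ _ fy)/cls[t' tB Et']].
  exists (t * s)%g; last by rewrite (perm_wordM inj_e) -Et (perm_wordKV inj_e).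
  rewrite groupM //; apply/(subsetP (joing_subl _ _)); rewrite inE tH /=.
  by rewrite (perm_word_inj inj_e cu (s := t) (t := t')) // -Et.
- move=> b d [s sL ->] /(back _ _ _ fz)/cls[t tA Et].
  exists (t * s)%g; last by rewrite (perm_wordM inj_e) -Et (perm_wordKV inj_e).
  by rewrite groupM //; apply/(subsetP (joing_subr _ _)).
Qed.

(** Linking two incomparable words makes both stabilizers act on one orbit:
    the theory that links [u] to [v] lies below the one that also identifies
    the orbit of [u] under [<[g]>], and modularity for this pair would fail if
    [g] arose only from the interaction of the two stabilizers. *)
Lemma stab_prime_order u v g : codom e =i letters u -> codom e =i letters v ->
  incomparable u v -> ~ sat0 N u -> ~ sat0 N v -> prime #[g]%g ->
  g \in (H u <*> H v)%G -> g \in H u \/ g \in H v.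
Proof.
move=> cu cv inc nu nv pg gHK; apply: contrapT => ng.
have ngu : g \notin H u by apply/negP => h; apply: ng; left.
have ngv : g \notin H v by apply/negP => h; apply: ng; right.
have uv : u = v \/ incomparable u v by right.
pose B := <[g]>%G; pose O := 1%G : {group {perm T}}.
pose z := link e u v O; pose y := link e u v B.
have fz : fully_invariant z := link_fic e u v O.
have fy : fully_invariant y := link_fic e u v B.
have fv := sat_fic V.
have [k zk] := link_aperiodic e u v O.
have fj := jn_fic fv fz.
have uvj : congr_join (sat V) z u v by apply: jnS (jn0 _ _ _) _; right; apply: link_uv.
have vz : congr_join (sat V) z u (perm_word e g u).
  suff : g \in Group (stab_rel_group inj_e u fj) by rewrite inE => /asboolP.
  apply: subsetP gHK; rewrite join_subG; apply/andP; split; apply/subsetP => s hs;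
    rewrite inE; apply/asboolP.
    by apply: jnS (jn0 _ _ _) _; left; apply: stab_sat.
  apply: (fic_trans fj uvj).
  apply: (fic_trans fj _ (fic_perm_word e s fj (fic_sym fj uvj))).
  by apply: jnS (jn0 _ _ _) _; left; apply: stab_sat.
have yg : y u (perm_word e g u) by apply: link_u; apply: cycle_id.
have := weakly_modular_theory mV fy fz (link_mono (sub1G B)) zk vz yg => h.
have disj s t : perm_word e s u <> perm_word e t v.
  move=> E; case: inc => n1 _; apply: n1.
  apply: word_le_trans (perm_word_le inj_e s u).1 _; rewrite E.
  exact: (perm_word_le inj_e t v).2.
have cls (C : {group {perm T}}) t : link e u v C u t \/ link e u v C v t ->
    link_orbit e u v C t.
  case; apply: link_class => //; first by exists 1%g => //; left; rewrite perm_word1.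
  by exists 1%g => //; right; rewrite perm_word1.
have tiu s : s \in H u -> s \in B -> s = 1%g.
  move=> su sB; apply/set1gP; rewrite -(prime_TIg (G := B) (H := H u)) ?cycle_subG //.
  by rewrite inE sB su.
have tiv s : s \in H v -> s \in B -> s = 1%g.
  move=> su sB; apply/set1gP; rewrite -(prime_TIg (G := B) (H := H v)) ?cycle_subG //.
  by rewrite inE sB su.
have : perm_word e g u = u \/ perm_word e g u = v.
  apply: (jn_inv (P := fun t => t = u \/ t = v) h); first by left.
    move=> b d [] -> [vd yd].
      have [s sH Es] := sat_orbit cu nu vd; have [t tB] := cls B d (or_introl yd).
      rewrite Es; case=> [E|/disj //]; have Est := perm_word_inj inj_e cu E.
      by left; rewrite (tiu s) ?perm_word1 // Est.
    have [s sH Es] := sat_orbit cv nv vd; have [t tB] := cls B d (or_intror yd).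
    rewrite Es; case=> [E|E]; first by case: (disj _ _ (esym E)).
    have Est := perm_word_inj inj_e cv E.
    by right; rewrite (tiv s) ?perm_word1 // Est.
  move=> b d hb hz; have : link_orbit e u v O d.
    by apply: cls; case: hb hz => ->; [left | right].
  by case=> s /set1gP-> [] ->; rewrite perm_word1; [left | right].
case=> E; last by apply: (disj g 1%g); rewrite perm_word1.
have g1 : g = 1%g by apply: (perm_word_inj inj_e cu); rewrite perm_word1.
by rewrite g1 order1 in pg.
Qed.

End Stabilizers.

Lemma condition_bP : condition_b N.
Proof.
move=> u nu A B; rewrite -[(A <= B)%O]/(A \subset B) => sAB.
have cu : codom (alph_val (u := u)) =i letters u.
  move=> x; apply/codomP/idP => [[i ->]|hx]; first exact: valP.
  by exists (SeqSub hx).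
apply/val_inj/eqP; rewrite eqEsubset; apply/andP; split.
  apply/subsetP => g /setIP[gHA gB].
  exact: (stab_modular (inj_e := @alph_val_inj u) cu nu sAB gHA gB).
change (((Stab N u :&: B) <*> A)%g \subset (Stab N u <*> A)%g :&: B).
rewrite join_subG !subsetI subsetIr sAB joing_subr !andbT.
exact: subset_trans (subsetIl _ _) (joing_subl _ _).
Qed.

End Conditions.

(** * Stabilizers that contain transpositions *)

Section Transpositions.
Variable T : finType.
Implicit Types a b c : T.

Definition distinct3 a b c : Prop := [/\ a != b, a != c & b != c].

Lemma tperm_neq a b c : distinct3 a b c -> tperm a c <> tperm a b.
Proof.
case=> ab ac bc /(congr1 (fun s : {perm T} => s a)); rewrite !tpermL => E.
by rewrite E eqxx in bc.
Qed.

Lemma order_tperm a b : a != b -> #[tperm a b]%g = 2.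
Proof.
move=> ab; apply/prime_nt_dvdP => //; last by rewrite order_dvdn expgS expg1 tperm2.
rewrite order_eq1; apply/eqP => /(congr1 (fun s : {perm T} => s a)).
by rewrite tpermL perm1 => E; rewrite E eqxx in ab.
Qed.

Lemma order_3cycle a b c : distinct3 a b c -> #[tperm a b * tperm a c]%g = 3.
Proof.
move=> h; have [ab ac bc] := h; apply/prime_nt_dvdP => //.
  rewrite order_eq1; apply/eqP => /(canRL (mulgK _)).
  by rewrite mul1g tpermV => /esym; apply: tperm_neq.
have [ba ca cb] : [/\ b != a, c != a & c != b] by rewrite ![_ == a]eq_sym ![c == b]eq_sym.
pose g := (tperm a b * tperm a c)%g.
have ga : g a = b by rewrite permM tpermL tpermD // eq_sym.
have gb : g b = c by rewrite permM tpermR tpermL.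
have gc : g c = a by rewrite permM (tpermD (x := a) (y := b)) // tpermR.
have gx x : x != a -> x != b -> x != c -> g x = x.
  by move=> xa xb xc; rewrite permM !tpermD // eq_sym.
rewrite -/g order_dvdn; apply/eqP/permP => x; clearbody g.
rewrite !expgS expg0 mulg1 !permM perm1.
have [->|xa] := eqVneq x a; first by rewrite ga gb gc.
have [->|xb] := eqVneq x b; first by rewrite gb gc ga.
have [->|xc] := eqVneq x c; first by rewrite gc ga gb.
by rewrite !gx.
Qed.

Lemma perm3 a b c a' b' c' : distinct3 a b c -> distinct3 a' b' c' ->
  exists t : {perm T}, [/\ t a = a', t b = b' & t c = c'].
Proof.
move=> [ab ac bc] [ab' ac' bc'].
pose t1 := tperm a a'; pose t2 := (t1 * tperm (t1 b) b')%g.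
have t2a : t2 a = a'.
  rewrite permM [t1 a]tpermL tpermD //; last by rewrite eq_sym.
  by rewrite -[X in _ != X](tpermL a a') (inj_eq perm_inj) eq_sym.
have t2b : t2 b = b' by rewrite permM tpermL.
clearbody t2; exists (t2 * tperm (t2 c) c')%g; rewrite !permM t2a t2b tpermL; split=> //.
  by rewrite tpermD // -?t2a ?(inj_eq perm_inj) // ?t2a // eq_sym.
by rewrite tpermD // -?t2b ?(inj_eq perm_inj) // ?t2b // eq_sym.
Qed.

End Transpositions.

(** The common feature of the subgroups [T_ij] of [S_3] and [I_ij,st] of [S_4]
    on which condition (c) rests. *)
Definition splits_transpositions (T : finType) (A : {set {perm T}}) : Prop :=
  exists a b c : T, [/\ distinct3 a b c, tperm a b \in A & tperm a c \notin A].

Lemma pt_neq k i j : 0 < i <= k.+1 -> 0 < j <= k.+1 -> i != j -> pt k i != pt k j.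
Proof.
move=> /andP[i0 ik] /andP[j0 jk]; apply: contraNneq => /(congr1 val).
by rewrite /pt /= !inordK ?prednK // => E; rewrite -(prednK i0) E prednK.
Qed.

Lemma T3_splits A : A \in T3s -> splits_transpositions A.
Proof.
have key i j k : distinct3 (pt 2 i) (pt 2 j) (pt 2 k) -> splits_transpositions (T3 i j).
  move=> h; exists (pt 2 i), (pt 2 j), (pt 2 k); split=> //; first exact: cycle_id.
  have [ij ik jk] := h.
  rewrite /T3 cycle2g; last exact: order_tperm.
  rewrite !inE negb_or; apply/andP; split; apply/eqP; last exact: tperm_neq.
  move=> /(congr1 (fun s : 'S_3 => s (pt 2 i))); rewrite tpermL perm1 => E.
  by rewrite E eqxx in ik.
rewrite !inE => /or3P[] /eqP->.
- by apply: (key 1 2 3); split; apply: pt_neq.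
- by apply: (key 2 3 1); split; apply: pt_neq.
- by apply: (key 1 3 2); split; apply: pt_neq.
Qed.

Lemma I4_splits A : A \in I4s -> splits_transpositions A.
Proof.
have key i j s t : distinct3 (pt 3 i) (pt 3 j) (pt 3 s) -> distinct3 (pt 3 i) (pt 3 j) (pt 3 t) ->
    pt 3 s != pt 3 t -> splits_transpositions (I4 i j s t).
  move=> h h' st; exists (pt 3 i), (pt 3 j), (pt 3 s); split=> //.
    case: h h' => ij si js [_ it jt]; rewrite inE !imsetU1 !imset_set1.
    rewrite tpermL tpermR imsetU1 imset_set1 !tpermD // [[set pt 3 j; pt 3 i]]setUC.
    exact: eqxx.
  rewrite inE; apply/eqP => /setP/(_ [set pt 3 s; pt 3 j]).
  case: h h' => ij si js [_ it jt].
  have -> : [set pt 3 s; pt 3 j] \in [set tperm (pt 3 i) (pt 3 s) @: B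
      | B : {set 'I_4} in [set [set pt 3 i; pt 3 j]; [set pt 3 s; pt 3 t]]].
    apply/imsetP; exists [set pt 3 i; pt 3 j]; first by rewrite set21.
    by rewrite imsetU1 imset_set1 tpermL tpermD // eq_sym.
  move=> /esym; rewrite !inE => /orP[] /eqP /setP E.
    by have := E (pt 3 i); rewrite !inE eqxx (negPf si) (negPf ij).
  by have := E (pt 3 j); rewrite !inE eqxx orbT (negPf js) (negPf jt).
rewrite !inE => /or3P[] /eqP->.
- by apply: (key 1 2 3 4); try split; apply: pt_neq.
- by apply: (key 1 3 2 4); try split; apply: pt_neq.
- by apply: (key 1 4 2 3); try split; apply: pt_neq.
Qed.

Section ConditionC.
Variables V N : SEM.
Hypotheses (mV : weakly_modular V) (nilN : nil_variety N).
Hypothesis VN : forall p q, sat V p q -> sat N p q.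
Hypothesis NV : forall p q, letters p =i letters q -> sat N p q -> sat V p q.

Section Pair.
Variables (T : finType) (e : T -> letter) (u v : word).
Hypotheses (inj_e : injective e) (cu : codom e =i letters u) (cv : codom e =i letters v).
Hypothesis uv : incomparable u v.

Let not_sat0 w s : s \notin stab N e w -> ~ sat0 N w.
Proof. by move=> hs h; rewrite (stab_sat0 nilN e h) inE in hs. Qed.

Local Notation H := (stab_group N inj_e).

(** After renaming [v], the transposition [(a b)] lies in the first stabilizer
    only and [(a c)] in the second one only. Their product is a 3-cycle, which
    then lies in neither of the stabilizers. *)
Lemma stabs_not_both_split :
  splits_transpositions (stab N e u) -> splits_transpositions (stab N e v) -> False.
Proof.
move=> [a [b [c [d3 abu acu]]]] [a' [b' [c' [d3' abv acv]]]].
have [ab ac bc] := d3.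
have [|t [ta tb tc]] := perm3 d3' (a' := a) (b' := c) (c' := b).
  by split=> //; rewrite eq_sym.
pose v' := perm_word e t v.
have cv' : codom e =i letters v' by move=> x; rewrite perm_word_letters.
have uv' : incomparable u v'.
  case: uv => n1 n2; split=> h; [apply: n1 | apply: n2].
    exact: word_le_trans h (perm_word_le inj_e t v).2.
  exact: word_le_trans (perm_word_le inj_e t v).1 h.
have acv' : tperm a c \in stab N e v'.
  by rewrite -ta -tb -tpermJ; apply: stab_conj.
have abv' : tperm a b \notin stab N e v'.
  apply: contra acv => h; have := stab_conj inj_e t^-1%g h.
  by rewrite tpermJ -{1}ta -{1}tc !permK (perm_wordK inj_e).
have := stab_prime_order (inj_e := inj_e) mV nilN VN NV cu cv' uv' (not_sat0 acu) (not_sat0 abv').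
move=> /(_ (tperm a b * tperm a c)%g); rewrite order_3cycle //; case=> //.
- by rewrite groupM // mem_gen // inE ?abu ?acv' ?orbT.
- by move=> h; rewrite -(groupMl (G := H u) (x := tperm a b)) ?(negPf acu) // in acu; case/negP: acu.
- move=> h; case/negP: abv'.
  by rewrite -(mulgK (tperm a c) (tperm a b)) tpermV -[_ \in _]/(_ \in H v') groupM.
Qed.

(** The product of the transpositions [(a b)] and [(a c)] is even, so [(a c)] is
    generated by the two stabilizers without lying in either of them. *)
Lemma stabs_not_split_Alt :
  splits_transpositions (stab N e u) -> stab N e v = ('Alt_T)%g -> False.
Proof.
move=> [a [b [c [d3 abu acu]]]] Ev; have [ab ac bc] := d3.
have acv : tperm a c \notin stab N e v by rewrite Ev Alt_even odd_tperm ac.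
have := stab_prime_order (inj_e := inj_e) mV nilN VN NV cu cv uv (not_sat0 acu) (not_sat0 acv).
move=> /(_ (tperm a c)); rewrite order_tperm //; case=> //; last 2 first.
- by move=> h; case/negP: acu.
- by move=> h; case/negP: acv.
have -> : tperm a c = (tperm a b * (tperm a b * tperm a c))%g by rewrite mulgA tperm2 mul1g.
rewrite groupM // mem_gen // inE; first by rewrite abu.
by apply/orP; right; rewrite /= Ev Alt_even odd_permM !odd_tperm ab ac.
Qed.

End Pair.

Lemma condition_cP : condition_c N.
Proof.
move=> [u [v [inc uv]]]; have cv k (e : 'I_k -> letter) : enumerates e u -> codom e =i letters v.
  by move=> [_ h] x; rewrite h uv.
case=> -[e [en hu hv]]; have [inj_e cu] := en.
- exact: (stabs_not_both_split inj_e cu (cv _ _ en) inc (T3_splits hu) (T3_splits hv)).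
- exact: (stabs_not_split_Alt inj_e cu (cv _ _ en) inc (T3_splits hu) hv).
- exact: (stabs_not_both_split inj_e cu (cv _ _ en) inc (I4_splits hu) (I4_splits hv)).
- exact: (stabs_not_split_Alt inj_e cu (cv _ _ en) inc (I4_splits hu) hv).
Qed.

End ConditionC.

(** * Semigroup varieties *)

Lemma eval_const (w : word) : eval (fun=> word1 0 : F) w = xpow 0 (len w).-1.
Proof.
apply: letters_inj; rewrite letters_eval letters_xpow prednK // /len.
by elim: (letters w) => //= x s ->.
Qed.

Lemma periodic_of_len V a b : sat V a b -> len a < len b ->
  exists m m', m < m' /\ sat V (xpow 0 m) (xpow 0 m').
Proof.
move=> ab hlt; exists (len a).-1, (len b).-1; rewrite -!eval_const; split.
  by rewrite -ltnS !prednK.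
exact: (fic_subst (sat_fic V)).
Qed.

(** Distinct words of equal length become incomparable in one direction after
    a prefix letter marks one of their differences. *)
Lemma nontrivial_periodic V a b : weakly_modular V -> sat V a b -> a <> b ->
  exists m m', m < m' /\ sat V (xpow 0 m) (xpow 0 m').
Proof.
move=> mV ab nab; have fv := sat_fic V.
have [h|h|E] := ltngtP (len a) (len b); first exact: periodic_of_len ab h.
  exact: periodic_of_len (fic_sym fv ab) h.
have [i ia ni] : exists2 i, i < len a & nth 0 (letters a) i <> nth 0 (letters b) i.
  apply: contrapT => h; apply: nab; apply: letters_inj.
  apply: (@eq_from_nth _ 0) => // i hi; apply: contrapT => ni; apply: h; by exists i.
pose f z := if z == nth 0 (letters a) i then 0 else 1.
pose pre c : F := (word1 0 : F) ** rename f c.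
have nth0 c : nth 0 (letters (pre c)) 0 = 0 by [].
have nthS c : i < len c -> nth 0 (letters (pre c)) i.+1 = f (nth 0 (letters c) i).
  by move=> h; rewrite -(nth_map 0 0 f).
have lp c : len (pre c) = (len c).+1 by rewrite len_mul len_rename.
have np : ~ word_le (pre a) (pre b).
  move=> /word_leP[g [p [q Eb]]].
  have [|h [Eh _ _ _]] := ctx_eval_rename (esym Eb); first by rewrite !lp E.
  have Eb' j : j < (len a).+1 ->
      nth 0 (letters (pre b)) j = h (nth 0 (letters (pre a)) j).
    by move=> hj; rewrite Eh letters_rename (nth_map 0) // -/(len _) lp.
  have h0 := Eb' 0 isT; have hS := Eb' i.+1 ia.
  rewrite !nth0 in h0; rewrite !nthS -?E // /f eqxx -h0 in hS.
  by move: hS; case: eqP => // /esym/ni.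
have pab : sat V (pre b) (pre a).
  apply: (fic_mul fv); first exact: (fic_refl fv).
  by rewrite !renameE; apply: (fic_subst fv); apply: (fic_sym fv).
have [p hp] := left_multiple mV pab np.
by apply: periodic_of_len hp _; rewrite len_mul -[X in X < _]add0n ltn_add2r.
Qed.

Lemma periodic_swaps V m m' : weakly_modular V -> m < m' ->
  sat V (xpow 0 m) (xpow 0 m') -> swaps (sat V) m.
Proof.
move=> mV hm h p q x y u xu yu.
apply: (swap_of_longer (w := ctx p q (xpow 0 m'))) => //.
  exact: fic_ctx (sat_fic V) h.
by rewrite !len_ctx !len_xpow ltn_add2r ltn_add2l.
Qed.

Lemma nontrivial_identity V : V <> SEM_all -> exists a b, sat V a b /\ a <> b.
Proof.
move=> nV; apply: contrapT => h; apply: nV; apply: SEM_ext => S; split=> // _.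
apply: sg_birkhoff => a b ab; suff -> : a = b by [].
by apply: contrapT => nab; apply: h; exists a, b.
Qed.

Lemma weakly_modular_conditions V n : weakly_modular V ->
  (forall S, V S -> semilattice_powers n S) ->
  exists M N : SEM, [/\ M = SEM_T \/ M = SL, nil_variety N, V = Order.join M N
    & [/\ condition_a N, condition_b N & condition_c N]].
Proof.
move=> mV hV; have [M [N [hM nN VE NV]]] := semilattice_powers_decomposition hV.
have VN p q : sat V p q -> sat N p q.
  move=> h S NS; apply: h; rewrite VE; change (sem_join M N S).
  by move=> X _ NX; apply: NX.
exists M, N; split=> //; split; [exact: condition_aP mV nN VN NV | |].
  exact: condition_bP mV nN VN NV.
exact: condition_cP mV nN VN NV.
Qed.

Theorem modular_semigroup_variety V : V <> SEM_all -> modular_element V ->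
  exists M N : SEM, [/\ M = SEM_T \/ M = SL, nil_variety N, V = Order.join M N
    & [/\ condition_a N, condition_b N & condition_c N]].
Proof.
move=> /nontrivial_identity[a [b [ab nab]]] /modular_weakly mV.
have [m [m' [hm h]]] := nontrivial_periodic mV ab nab.
have sw := periodic_swaps mV hm h.
apply: (weakly_modular_conditions (n := m.+3)) => // S VS.
by apply: swaps_semilattice_powers => p q x y u xu yu; apply: (sw p q x y xu yu).
Qed.

(** * Aperiodic epigroup varieties *)

Lemma aperiodic_add n j (S : semigroup) (x : S) : aperiodic n S ->
  sg_exp x (n + j) = sg_exp x n.
Proof. by move=> h; elim: j => [|j IH]; rewrite ?addn0 // addnS sg_expSr IH h. Qed.

Lemma aperiodic_mono n k (S : semigroup) : n <= k -> aperiodic n S -> aperiodic k S.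
Proof. by move=> /subnKC <- h x; rewrite !aperiodic_add ?h. Qed.

(** The subgroups of an aperiodic semigroup are trivial, so the pseudoinverse is
    the idempotent power. *)
Lemma aperiodic_pseudoinverse n (S : semigroup) (x y : S) : aperiodic n S ->
  is_pseudoinverse x y <-> y = sg_exp x n.
Proof.
move=> ap; split=> [/pseudoinverseP[xy yxy [j hj]]|->]; last first.
  apply/pseudoinverseP; rewrite -(sg_exp_comm n (erefl (x ** x))) ap.
  by split=> //; [apply: aperiodic_idem | exists n; apply: aperiodic_idem].
have hy i : sg_exp x i ** sg_exp y i.+1 = y.
  elim: i => [|i IH]; first by rewrite -[LHS]/(x ** (y ** y)) mulA xy yxy.
  by rewrite sg_expS (sg_expSr y) -mulA (mulA (sg_exp x i)) IH mulA xy yxy.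
have hn i : sg_exp x (i + j) ** (x ** y) = sg_exp x (i + j).
  by elim: i => // i IH; rewrite addSn sg_expS -mulA IH.
have ey : sg_exp x n ** y = sg_exp x n.
  by have := hn n; rewrite aperiodic_add // mulA ap.
have ei i : sg_exp x n ** sg_exp y i = sg_exp x n.
  by elim: i => // i IH; rewrite sg_expSr mulA IH.
by rewrite -(hy n) ei.
Qed.

Definition pow_usg (n : nat) (S : semigroup) : unary_semigroup :=
  @MkUnarySemigroup S (fun x => sg_exp x n).

Section EpiOf.
Variables (n : nat) (W : SEM).

Definition epi_of_class (U : unary_semigroup) : Prop :=
  [/\ W U, aperiodic n U & forall x : U, un x = sg_exp x n].

Lemma epi_of_variety : usg_variety epi_of_class.
Proof.
have [WH WS WP] := sem_variety W; split.
- move=> S T f [hf uf] sf [WS1 ap us]; split; first exact: WH hf sf WS1.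
    by move=> y; have [x <-] := sf y; rewrite -(sg_hom_exp hf) -hf ap.
  by move=> y; have [x <-] := sf y; rewrite -uf us (sg_hom_exp hf).
- move=> S T f [hf uf] jf [WS1 ap us]; split; first exact: WS hf jf WS1.
    by move=> x; apply: jf; rewrite hf (sg_hom_exp hf) ap.
  by move=> x; apply: jf; rewrite uf us (sg_hom_exp hf).
- move=> I S h; split; first by apply: WP => i; case: (h i).
    move=> x; apply: functional_extensionality_dep => i.
    by rewrite /= /prod_mul sg_exp_prod; case: (h i).
  move=> x; apply: functional_extensionality_dep => i.
  by rewrite sg_exp_prod /=; case: (h i).
Qed.

Lemma epi_of_epigroup U : epi_of_class U -> is_epigroup_algebra U.
Proof.
case=> _ ap us; apply: pseudoinverse_epigroup => x.
by rewrite us; apply/aperiodic_pseudoinverse.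
Qed.

(** The epigroup variety that is identified with the aperiodic part of [W]. *)
Definition epi_of : EPI := MkEPI epi_of_variety epi_of_epigroup.

Lemma epi_of_identified : (forall S, W S -> aperiodic n S) -> identified epi_of W.
Proof.
move=> ap U; split=> [h|[[_ hU] WU]]; first by split; [apply: epi_of_epigroup | case: h].
by split=> //; [apply: ap | move=> x; apply/(aperiodic_pseudoinverse _ _ (ap _ WU))].
Qed.

End EpiOf.

Lemma pow_reducts_variety n (X : EPI) :
  sg_variety (fun S => aperiodic n S /\ X (pow_usg n S)).
Proof.
have [XH XS XP] := epi_variety X; split.
- move=> S T f hf sf [ap XS1]; split.
    by move=> y; have [x <-] := sf y; rewrite -(sg_hom_exp hf) -hf ap.
  by apply: (XH (pow_usg n S) (pow_usg n T) f) => //; split=> // x; rewrite /= (sg_hom_exp hf).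
- move=> S T f hf jf [ap XS1]; split.
    by move=> x; apply: jf; rewrite hf (sg_hom_exp hf) ap.
  by apply: (XS (pow_usg n S) (pow_usg n T) f) => //; split=> // x; rewrite /= (sg_hom_exp hf).
- move=> I S h; split.
    move=> x; apply: functional_extensionality_dep => i.
    by rewrite /= /prod_mul sg_exp_prod; case: (h i).
  apply: (XH (usg_prod (fun i => pow_usg n (S i))) (pow_usg n (sg_prod S)) (fun x => x)).
  + by split=> // x; apply: functional_extensionality_dep => i; rewrite /= sg_exp_prod.
  + by move=> x; exists x.
  + by apply: XP => i; case: (h i).
Qed.

Definition pow_reducts n X : SEM := MkSEM (pow_reducts_variety n X).

Lemma epi_pow_usg (X : EPI) n (U : unary_semigroup) :
  (forall x : U, un x = sg_exp x n) -> X U <-> X (pow_usg n U).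
Proof.
have [XH _ _] := epi_variety X => h; split.
  by apply: (XH U (pow_usg n U) (fun x => x)); [split=> // x; rewrite h | move=> x; exists x].
by apply: (XH (pow_usg n U) U (fun x => x)); [split=> // x; rewrite h | move=> x; exists x].
Qed.

(** In aperiodic epigroups the pseudoinverse is a power, so that terms become
    words. *)
Fixpoint power_word (n : nat) (t : uterm letter) : F :=
  match t with
  | UVar x => word1 x
  | UMul s t => power_word n s ** power_word n t
  | UUn t => sg_exp (power_word n t) n
  end.

Fixpoint bar_free (t : uterm letter) : bool :=
  match t with
  | UVar _ => true
  | UMul s t => bar_free s && bar_free t
  | UUn _ => false
  end.

Lemma ueval_power_word n (U : unary_semigroup) (phi : letter -> U) t :
  (forall x : U, un x = sg_exp x n) -> ueval phi t = eval phi (power_word n t).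
Proof.
move=> h; elim: t => //= [s -> t ->|t ->]; first by rewrite evalM.
by rewrite h (sg_hom_exp (@eval_hom U phi)).
Qed.

Lemma ueval_bar_free n (U : unary_semigroup) (phi : letter -> U) t :
  bar_free t -> ueval phi t = eval phi (power_word n t).
Proof. by elim: t => //= s hs t ht /andP[/hs-> /ht->]; rewrite evalM. Qed.

Lemma len_exp (a : F) n : n < len (sg_exp a n).
Proof. by elim: n => // n IH; rewrite sg_expS len_mul -add1n leq_add. Qed.

Lemma len_power_word n t : ~~ bar_free t -> n < len (power_word n t).
Proof.
elim: t => //= [s hs t ht|t _]; last by rewrite len_exp.
rewrite negb_and len_mul => /orP[/hs h|/ht h].
  exact: leq_trans h (leq_addr _ _).
exact: leq_trans h (leq_addl _ _).
Qed.

(** * Modular epigroup varieties *)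

Definition reduct_sat (V : EPI) (a b : F) : Prop := forall U, V U -> sg_sat U a b.

Lemma reduct_sat_fic V : fully_invariant (reduct_sat V).
Proof. exact: (sat_on_fic reduct V). Qed.

Lemma epi_modular_le (V Y Z : EPI) : modular_element V -> (forall U, Y U -> Z U) ->
  forall U, epi_join_class V Y U -> Z U -> epi_join_class (epi_meet V Z) Y U.
Proof.
move=> mV YZ U VY ZU; have /mV E : (Y <= Z)%O by apply/asboolP.
suff : (Order.join (Order.meet V Z) Y : EPI) U by [].
by rewrite -E.
Qed.

(** The argument of [swap_of_longer], with the identity [t = t x (un x)] for
    [t = x^(n+1)] in the role of an identity between [u] and a longer word: in
    the test varieties the pseudoinverse is a power that exceeds [u]. *)
Lemma epi_swaps V : modular_element V -> exists n, swaps (reduct_sat V) n.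
Proof.
move=> mV; have [n hn] := epi_boundedP V; exists n => p q x y u xu yu.
have fv := reduct_sat_fic V; pose u' := rename (swp x y) u.
pose y0 := swap_gen u x y; pose z0 := collapse u; pose k := len u.
have fy : fully_invariant y0 by apply: swap_gen_fic.
have fz : fully_invariant z0 by apply: collapse_fic.
pose Z := epi_of k (Var z0); pose Y := epi_of k (Var y0).
have YZ U : Y U -> Z U.
  by case=> h1 h2 h3; split=> // a b /(collapse_swap x y); apply: h1.
have long a b : k < len a -> k < len b -> z0 a b by apply: collapse_long.
have zk : z0 (xpow 0 k ** word1 0) (xpow 0 k).
  by apply: long; rewrite ?len_mul len_xpow // addn1 ltnS ltnW.
have apz r (fr : fully_invariant r) : (forall a b, z0 a b -> r a b) -> aperiodic k (quot fr).
  move=> zr c; have := proj2 (quot_sat fr _ _) (zr _ _ zk) (fun=> c).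
  by rewrite evalM !eval_xpow.
pose r := congr_join (fun a b => reduct_sat V a b /\ y0 a b) z0.
have fr : fully_invariant r by apply: jn_fic => //; apply: fic_meet.
have zr a b : z0 a b -> r a b by move=> h; apply: jnS (jn0 _ _ _) _; right.
pose Q := pow_usg k (quot fr).
have ZQ : Z Q.
  by split=> //; [move=> a b /zr h; apply/quot_sat | apply: apz].
have YQ : Y (pow_usg k (quot fy)).
  by split=> //; [move=> a b h; apply/quot_sat | apply: apz => a b /(collapse_swap x y)].
have VYQ : epi_join_class V Y Q.
  move=> X VX YX; apply: (birkhoff (epi_variety X)) => s t st phi.
  have yst : y0 (power_word k s) (power_word k t).
    apply/(quot_sat fy) => psi.
    by have := st _ (YX _ YQ) psi; rewrite !(ueval_power_word (n := k)).
  rewrite !(ueval_power_word (n := k)) //; apply: (proj2 (quot_sat fr _ _)).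
  (* In [Y] a term with a pseudoinverse is a collapsed word; a word that equals
     it in [Y] is then collapsed too. *)
  have [fs|nfs] := boolP (bar_free s); last first.
    apply/zr/gen_ideal; first by left; apply: len_power_word.
    by apply: (swap_gen_D xu yu (fic_sym fy yst)); left; apply: len_power_word.
  have [ft|nft] := boolP (bar_free t); last first.
    apply/zr/gen_ideal; last by left; apply: len_power_word.
    by apply: (swap_gen_D xu yu yst); left; apply: len_power_word.
  apply: jnS (jn0 _ _ _) _; left; split=> // U VU psi.
  by rewrite -!(ueval_bar_free k psi) //; apply: st; apply: VX.
have := epi_modular_le mV YZ VYQ ZQ.
pose X := epi_of k (sem_meet (Var z0) (Var (fun a b => a = u /\ b = u'))).
move=> /(_ X) h; apply: (swap_chain xu yu fv); apply/(quot_sat fr).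
have [[_ QX] _ _] : X Q; last exact: QX.
apply: h => U; last first.
  case=> h1 h2 h3; split=> //; split; first by move=> a b /(collapse_swap x y); apply: h1.
  by move=> a b [-> ->]; apply: h1; apply: gen1.
case=> VU [zU ap unU]; split=> //; split=> // a b [-> ->].
have fU := sg_sat_fic U.
pose w := ctx p q (xpow 0 n ** ((word1 0 : F) ** xpow 0 k)).
have uw : sg_sat U u w.
  apply: (fic_ctx _ _ fU) => phi; rewrite !evalM !eval_xpow.
  by have [_ _] := hn U VU (phi 0); rewrite unU.
have lw : k < len w.
  by rewrite /k /u !len_ctx !len_mul !len_xpow ltn_add2r ltn_add2l -addn1 leq_add2l.
have ww' : sg_sat U w (rename (swp x y) w) by apply: zU; apply: long; rewrite ?len_rename.
apply: (fic_trans fU uw); apply: (fic_trans fU ww').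
by rewrite /u' !renameE; apply: (fic_subst fU); apply: (fic_sym fU).
Qed.

Section AperiodicEpi.
Variables (V : EPI) (W : SEM) (n : nat).
Hypotheses (apW : forall S, W S -> aperiodic n S).
Hypothesis VW : forall U, V U <-> is_epigroup_algebra U /\ W U.

Lemma epi_of_eq k U : n <= k -> V U <-> epi_of k W U.
Proof.
move=> nk; rewrite VW; apply: iff_sym.
by apply: epi_of_identified => S /apW; apply: aperiodic_mono.
Qed.

(** Aperiodic semigroup varieties, with powers as pseudoinverses, form a
    sublattice of the lattice of epigroup varieties. *)
Lemma epi_weakly_modular : modular_element V -> weakly_modular W.
Proof.
move=> mV j Y Z YZ apZ S VY ZS X WX YX.
(* Both [W] and [Z] are aperiodic with exponent [k]. *)
pose k := maxn n j.
have nk : n <= k by apply: leq_maxl.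
have apk T : Z T -> aperiodic k T by move=> /apZ; apply: aperiodic_mono; apply: leq_maxr.
have YZ' U : epi_of k Y U -> epi_of k Z U by case=> /YZ.
have VYS : epi_join_class V (epi_of k Y) (pow_usg k S).
  move=> X1 VX1 YX1; suff [] : pow_reducts k X1 S by [].
  apply: VY => T hT.
    have apT : aperiodic k T by apply: aperiodic_mono nk _; apply: apW.
    by split=> //; apply: VX1; apply/(epi_of_eq _ nk).
  have apT : aperiodic k T by apply: apk; apply: YZ.
  by split=> //; apply: YX1.
have ZkS : epi_of k Z (pow_usg k S) by split=> //; apply: apk.
have := epi_modular_le mV YZ' VYS ZkS.
move=> /(_ (epi_of k X)) []// U.
  move=> [/(epi_of_eq _ nk)[WU _ _] [ZU ap unU]]; split=> //; exact: WX.
by case=> YU ap unU; split=> //; apply: YX.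
Qed.

Lemma epi_join_of M N : W = Order.join M N ->
  identified (epi_of n M) M /\ identified (epi_of n N) N /\
  V = Order.join (epi_of n M) (epi_of n N).
Proof.
move=> WE.
have MW S : M S -> W S by rewrite WE => MS; change (sem_join M N S) => X MX _; apply: MX.
have NW S : N S -> W S by rewrite WE => MS; change (sem_join M N S) => X _ NX; apply: NX.
split; first by apply: epi_of_identified => S /MW/apW.
split; first by apply: epi_of_identified => S /NW/apW.
apply: EPI_ext => U; change (V U <-> epi_join_class (epi_of n M) (epi_of n N) U); split.
  move=> /(epi_of_eq _ (leqnn n))[WU ap unU] X MX NX.
  apply/(epi_pow_usg _ unU); suff [] : pow_reducts n X U by [].
  move: WU; rewrite WE => /(_ (pow_reducts n X)); apply=> S hS.
    have apS : aperiodic n S by apply/apW/MW.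
    by split=> //; apply: MX.
  have apS : aperiodic n S by apply/apW/NW.
  by split=> //; apply: NX.
by apply=> U' [hU ap unU]; apply/(epi_of_eq _ (leqnn n)); split=> //; [apply: MW | apply: NW].
Qed.

End AperiodicEpi.

Theorem modular_epigroup_variety V : modular_element V ->
  exists (M N : SEM) (M' N' : EPI),
    [/\ M = SEM_T \/ M = SL, nil_variety N,
        [/\ identified M' M, identified N' N & V = Order.join M' N']
      & [/\ condition_a N, condition_b N & condition_c N]].
Proof.
move=> mV; have [m sw] := epi_swaps mV; pose n := m.+3.
pose W := Var (reduct_sat V).
have VWr U : V U -> W U by move=> VU a b; apply.
have hW S : W S -> semilattice_powers n S.
  move=> WS; apply: swaps_semilattice_powers => p q x y u xu yu.
  by apply: WS; apply: (sw p q x y xu yu).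
have apW S : W S -> aperiodic n S by move=> /hW[].
have VW U : V U <-> is_epigroup_algebra U /\ W U.
  split=> [VU|[hU WU]]; first by split; [apply: epi_epigroup VU | apply: VWr].
  have unU (T : unary_semigroup) : W T -> is_epigroup_algebra T -> forall x : T, un x = sg_exp x n.
    by move=> WT [_ hT] x; apply/(aperiodic_pseudoinverse _ _ (apW _ WT)).
  apply: (birkhoff (epi_variety V)) => s t st phi.
  have E := unU U WU hU.
  rewrite !(ueval_power_word (n := n)) ?E //; apply: WU => T VT psi.
  have ET := unU T (VWr T VT) (epi_epigroup VT).
  by have := st T VT psi; rewrite !(ueval_power_word (n := n)).
have mW := epi_weakly_modular apW VW mV.
have [M [N [hM nN WE cond]]] := weakly_modular_conditions mW hW.
have [iM [iN VE]] := epi_join_of apW VW WE.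
by exists M, N, (epi_of n M), (epi_of n N).
Qed.

Theorem theorem1p1 :
  (forall V : SEM, V <> SEM_all -> modular_element V ->
     exists M N : SEM,
       [/\ M = SEM_T \/ M = SL, nil_variety N, V = Order.join M N
         & [/\ condition_a N, condition_b N & condition_c N]]) /\
  (forall V : EPI, modular_element V ->
     exists (M N : SEM) (M' N' : EPI),
       [/\ M = SEM_T \/ M = SL, nil_variety N,
           [/\ identified M' M, identified N' N & V = Order.join M' N']
         & [/\ condition_a N, condition_b N & condition_c N]]).
Proof.
split; [exact: modular_semigroup_variety | exact: modular_epigroup_variety].
Qed.
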